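(* Let $n\not\equiv 2\pmod 4$ be a positive integer which is not a prime power, let $\zeta_n$ be a primitive $n$-th root of unity, and let $K=\mathbb{Q}(\zeta_n+\zeta_n^{-1})$. Let $\mathrm{Mod}_T(n)$ denote the set of square-free positive integers $\ell$ such that there exists an Arakelov-modular lattice of trace type of level $\ell$ over $K$, and let $\tilde{n}$ be the product of all odd primes that ramify in $K/\mathbb{Q}$. If $n$ has any prime factor $p\equiv 1\pmod 4$, then $\mathrm{Mod}_T(n)=\emptyset$. Otherwise, \begin{enumerate} \item if $n$ is odd and has an even number of distinct prime factors, $\mathrm{Mod}_T(n)=\{\tilde{n}\}$; \item if $n$ is odd and has an odd number of distinct prime factors, $\mathrm{Mod}_T(n)=\emptyset$; \item if $n=4m$, where $m$ is odd, $\mathrm{Mod}_T(n)=\{\tilde{n}\}$; \item if $n=2^rm$, where $r\geq 3$ and $m$ is odd, $\mathrm{Mod}_T(n)=\{\tilde{n},2\tilde{n}\}$. \end{enumerate}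
   Context: Let $K$ be a totally real number field with ring of integers $\mathcal{O}_K$ and different $\mathcal{D}_K$ over $\mathbb{Q}$. An element $\alpha\in K^\times$ is totally positive if $\sigma(\alpha)>0$ for every embedding $\sigma:K\to\mathbb{R}$. An ideal lattice over $K$ is a pair $(I,\alpha)$, where $I$ is a (nonzero) fractional $\mathcal{O}_K$-ideal, $\alpha\in K^\times$ is totally positive, and $I$ carries the positive definite symmetric bilinear form $b_\alpha(x,y)=\mathrm{Tr}_{K/\mathbb{Q}}(\alpha xy)$. Its dual is $(I^*,\alpha)$ with $I^*=\alpha^{-1}\mathcal{D}_K^{-1}I^{-1}=\{x\in K: b_\alpha(x,y)\in\mathbb{Z}\ \forall y\in I\}$. For a positive integer $\ell$, $(I,\alpha)$ is Arakelov-modular of level $\ell$ if there exists $\beta\in K^\times$ such that $I=\beta I^*$ and $\ell=\beta^2$. It is of trace type if $\alpha=1$. *)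

(* Defs.v *)
From HB Require Import structures.
From mathcomp Require Import all_boot all_order all_algebra all_field.
From mathcomp Require Import boolp classical_sets fsbigop reals Rstruct.
Set Implicit Arguments.
Unset Strict Implicit.
Unset Printing Implicit Defensive.
Import Order.TTheory GRing.Theory Num.Theory.
Local Open Scope classical_set_scope.
Local Open Scope ring_scope.

Section NumberField.
Variable K : fieldExtType rat.
Implicit Types (I J P : set K) (a x y : K).

Definition ring_of_integers : set K := [set x | integralOver (intr : int -> K) x].

(* The trace of multiplication by [x]; it does not depend on the basis. *)
Definition field_trace x : rat :=
  \tr (passmx.mxof (vbasis {:K}) (vbasis {:K}) (amull x)).

Definition OK_submodule I : Prop :=
  [/\ I 0, forall x y, I x -> I y -> I (x + y) &
      forall c x, ring_of_integers c -> I x -> I (c * x)].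

Definition fractional_ideal I : Prop :=
  [/\ OK_submodule I, exists2 x, I x & x != 0 &
      exists2 d, ring_of_integers d /\ d != 0 &
        forall x, I x -> ring_of_integers (d * x)].

Definition totally_positive a : Prop :=
  a != 0 /\ forall sigma : {rmorphism K -> Rdefinitions.R}, 0 < sigma a.

Definition ideal_lattice I a : Prop := fractional_ideal I /\ totally_positive a.

Definition trace_form a x y : rat := field_trace (a * x * y).

Definition dual_lattice I a : set K :=
  [set x | forall y, I y -> trace_form a x y \is a Num.int].

Definition Arakelov_modular (l : nat) I a : Prop :=
  [/\ ideal_lattice I a, (0 < l)%N &
      exists b : K, [/\ b != 0, I = [set b * x | x in dual_lattice I a] &
                        l%:R = b ^+ 2]].

Definition prime_ideal P : Prop :=
  [/\ OK_submodule P, P `<=` ring_of_integers, ~ P 1 &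
      forall x y, ring_of_integers x -> ring_of_integers y ->
        P (x * y) -> P x \/ P y].

Definition ideal_mul I J : set K :=
  [set x | exists2 s : seq (K * K), (forall u, u \in s -> I u.1 /\ J u.2) &
           x = \sum_(u <- s) u.1 * u.2].

(* Some prime ideal above [p] has ramification index at least 2, i.e. its
   square divides (contains) the ideal generated by [p]. *)
Definition ramified (p : nat) : Prop :=
  prime p /\ exists2 P, prime_ideal P & ideal_mul P P p%:R.

(* The index set is finite because only finitely many primes ramify. *)
Definition odd_ramified_prod : nat :=
  \big[muln/1%N]_(p \in [set p | odd p /\ ramified p]) p.

Definition square_free (l : nat) : Prop := forall d, (d ^ 2 %| l)%N -> d = 1%N.

Definition ModT : set nat :=
  [set l | [/\ (0 < l)%N, square_free l & exists I, Arakelov_modular l I 1]].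

End NumberField.

Definition prime_power (n : nat) : Prop :=
  exists p k : nat, [/\ prime p, (0 < k)%N & n = (p ^ k)%N].

Arguments ModT K : clear implicits.
Arguments odd_ramified_prod K : clear implicits.

(* Main.v *)
From HB Require Import structures.
Require Import Defs.
From mathcomp Require Import all_boot all_order all_algebra all_field.
From mathcomp Require Import boolp classical_sets fsbigop reals Rstruct.
From mathcomp Require Import ring zify cyclic.
Import Order.TTheory GRing.Theory Num.Theory.
Local Open Scope classical_set_scope.
Local Open Scope ring_scope.
Set Implicit Arguments.
Unset Strict Implicit.
Unset Printing Implicit Defensive.

(** Let z be a primitive n-th root of unity, F = Q(z), A = Z[z], and let K be
    the real subfield. If I = b I^* with b^2 = l, the ideals satisfy
    I^2 = b D_K^{-1}. So everything is decided by parities of valuations: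
    those of b = sqrt l against those of the different. As n is not a prime
    power, F/K is unramified, hence these parities can be read off in F. (For
    n = 1 the field K is Q, and the only level is 1.)

    At a prime p dividing n, with r the exponent of p in n, put
    pi = 1 - z^m where m is the prime-to-p part of n. Then
    p ~ pi^e with e = p^(r-1) (p-1), and the different Phi_n'(z) of F has
    valuation s = r e - p^(r-1) (deriv_Phi_ram). For odd p this is odd, and
    sqrt l has valuation 0 or e/2, so p must divide l and e/2 must be odd,
    that is p = 3 mod 4 (level_odd). For p = 2 and r = 2 the valuation s is
    even while e/2 = 1, so l is odd (level_two); for r >= 3 all is even. At p
    not dividing n, p is unramified and cannot divide l (level_dvd). Thus l is
    the product N of the odd primes dividing n, or 2 N if 8 divides n, and
    sqrt l must lie in K. Since sqrt (-p) lies in F for p = 3 mod 4 and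
    conjugation changes its sign, a product of an even number of those, or
    their multiples by i when 4 divides n, is real; with an odd number of
    primes and n odd, sqrt N in K would put i in F, contradicting that 2 is
    unramified there.

    Valuations are replaced by divisibility by powers of pi in A_p, the
    localization of A at p. The quotient A_p / pi may have several factors, so
    this is not a valuation, but the quotient is reduced, because a^q = a mod pi for a fixed power q of p
    (frobenius_cong): z^q = z mod pi as soon as q = 1 mod m. Reducedness gives
    that pi y^2 in A_p implies y in A_p (unif_root_closed), which is all that
    the parity argument asks for. It also shows that integral elements lie in
    every A_p, hence in A, so that A is the ring of integers.

    The dual of A for the trace is computed by Euler's method: if tau is the
    top coordinate in the basis of powers of z, the coefficients of
    Phi_n / (X - z) form the dual basis for tau, and the trace from K to Q of
    x + conj x is tau (Phi_n'(z) x) (field_trace_rel). An ideal of the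
    wrong parity at p is refuted by modular_obstruction: modularity forces
    I in pi^(-j) A_p, while the relative traces of multiples of pi^(-j-1) are
    in I up to a prime-to-p integer. Conversely modular_exists takes
    I = K /\ g^{-1} A where g is a product of powers of the pi such that
    g^2 b and Phi_n'(z) are associate.

    The odd primes ramified in K are those dividing n. For p dividing n, a
    prime ideal containing K /\ pi A has p in its square, since e >= 2
    (ramified_dvd). For p not dividing n, O_K / p satisfies x^q = x, and an
    idempotent argument shows that p is in no square of a prime ideal
    (unramified). *)

(** * Trace of a sum of rank-one maps, minimality of cyclotomic polynomials *)

(** The trace of a sum of rank-one maps, over an arbitrary family e; this covers
    the image of a dual frame under a relative trace. *)
Lemma field_trace_dyad (K : fieldExtType rat) (m : nat) (x : K)
    (psi : 'I_m -> K -> rat) (e : 'I_m -> K) :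
  (forall j, scalar (psi j)) ->
  (forall y, x * y = \sum_j psi j y *: e j) ->
  field_trace x = \sum_j psi j (e j).
Proof.
move=> psi_lin xE; rewrite /field_trace /mxtrace.
pose L j : {linear K -> rat^o} := HB.pack (psi j : K -> rat^o)
  (GRing.isLinear.Build rat K rat^o *%R (psi j) (psi_lin j)).
transitivity (\sum_(i < \dim {:K}) \sum_j
    psi j (vbasis {:K})`_i * coord (vbasis {:K}) i (e j)).
  apply: eq_bigr => i _; rewrite !mxE /= passmx.vecof_delta lfunE /= xE.
  rewrite linear_sum; apply: eq_bigr => j _.
  by rewrite linearZ.
rewrite exchange_big; apply: eq_bigr => j _ /=.
have -> : psi j (e j) =
    L j (\sum_i coord (vbasis {:K}) i (e j) *: (vbasis {:K})`_i).
  by rewrite -coord_vbasis ?memvf.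
rewrite linear_sum; apply: eq_bigr => i _.
by rewrite linearZ /= mulrC.
Qed.

Section CyclotomicPolynomial.
Variables (F : fieldExtType rat) (n : nat) (z : F).
Hypothesis prim_z : n.-primitive_root z.

Local Notation PhiQ := (map_poly (intr : int -> rat) 'Phi_n).
Local Notation PhiF := (map_poly (intr : int -> F) 'Phi_n).

Lemma map_poly_intr_in_alg (p : {poly int}) :
  map_poly (in_alg F) (map_poly intr p) = map_poly intr p.
Proof.
by rewrite -map_poly_comp; apply: eq_map_poly => a /=; rewrite scaler_int.
Qed.

Lemma root_Cyclotomic_dvd (x : F) d :
  (0 < d)%N -> root (map_poly intr 'Phi_d) x -> x ^+ d = 1.
Proof.
move=> d0 r.
have: root (map_poly (intr : int -> F) ('X^d - 1)) x.
  rewrite -prod_Cyclotomic // (big_rem d) /= ?divisors_id //.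
  by rewrite rmorphM rootM r.
by rewrite rmorphB rmorph1 /= map_polyXn rootE !hornerE subr_eq0 => /eqP.
Qed.

Lemma Cyclotomic_root : root PhiF z.
Proof.
have n0 := prim_order_gt0 prim_z.
have: root (map_poly (intr : int -> F) ('X^n - 1)) z.
  by rewrite rmorphB rmorph1 /= map_polyXn rootE !hornerE (prim_expr_order prim_z) subrr.
rewrite -prod_Cyclotomic // rmorph_prod /= rootE horner_prod prodf_seq_eq0.
case/hasP=> d; rewrite -dvdn_divisors // => dn /= rd.
have d0 : (0 < d)%N := dvdn_gt0 n0 dn.
suff -> : n = d by [].
apply/eqP; rewrite eqn_dvd dn andbT.
by rewrite (prim_order_dvd prim_z) (root_Cyclotomic_dvd d0 rd).
Qed.

(** The common factor of q and Phi_n has a complex root, a primitive n-th root of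
    unity, whose minimal polynomial is known to be Phi_n. *)
Lemma Cyclotomic_min (q : {poly rat}) :
  root (map_poly (in_alg F) q) z -> PhiQ %| q.
Proof.
move=> rq; have n0 := prim_order_gt0 prim_z.
have nzPhi : PhiQ != 0.
  by rewrite map_poly_eq0_id0 ?monic_neq0 ?Cyclotomic_monic // intr_eq0
    (monicP (Cyclotomic_monic n)).
pose g := gcdp PhiQ q.
have rg : root (map_poly (in_alg F) g) z.
  rewrite gcdp_map root_gcd map_poly_intr_in_alg rq.
  by rewrite Cyclotomic_root.
have g1 : size (map_poly (ratr : rat -> algC) g) != 1%N.
  rewrite size_map_poly -(size_map_poly (in_alg F)).
  rewrite gtn_eqF //; apply: root_size_gt1 rg.
  by rewrite map_poly_eq0 gcdp_eq0 (negPf nzPhi).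
have [w rw] := closed_rootP _ g1.
have rwPhi : root (map_poly (intr : int -> algC) 'Phi_n) w.
  have -> : map_poly (intr : int -> algC) 'Phi_n = map_poly ratr PhiQ.
    by rewrite -map_poly_comp; apply: eq_map_poly => a /=; rewrite ratr_int.
  have /dvdpP[s ->] : map_poly ratr g %| map_poly (ratr : rat -> algC) PhiQ.
    by rewrite dvdp_map dvdp_gcdl.
  by rewrite rootM rw orbT.
have [w0 prim_w0] := C_prim_root_exists n0.
have prim_w : n.-primitive_root w.
  by rewrite -(root_cyclotomic prim_w0) -(Cintr_Cyclotomic prim_w0).
have [p [Dp _] pmin] := minCpolyP w.
suff <- : p = PhiQ.
  by apply: (@dvdp_trans _ g); rewrite -?pmin // dvdp_gcdr.
apply: (map_poly_inj (ratr : {rmorphism rat -> algC})).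
rewrite -Dp (minCpoly_cyclotomic prim_w) -(Cintr_Cyclotomic prim_w).
by rewrite -map_poly_comp; apply: eq_map_poly => a /=; rewrite ratr_int.
Qed.

End CyclotomicPolynomial.

(** * The ring Z[z] and its localizations *)

(** For transporting a membership obtained by closure rules along an identity
    proved by [field]. *)
Lemma mem_eq (T : Type) (S : {pred T}) x y : x \in S -> x = y -> y \in S.
Proof. by move=> Sx <-. Qed.

Notation rat_generated z :=
  (forall x, exists P : {poly rat}, x = (map_poly (in_alg _) P).[z]).

Definition cycint (F : fieldExtType rat) (z : F) : {pred F} :=
  [pred x | `[< exists P : {poly int}, x = (map_poly intr P).[z] >]].

(** The localization of Z[z] at p. Coprimality, as opposed to non-divisibility,
    makes it a subring whether or not p is prime. *)
Definition cycloc (p : nat) (F : fieldExtType rat) (z : F) : {pred F} :=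
  [pred x | `[< exists2 N : nat, coprime p N & N%:R * x \in cycint z >]].

(** Nonzeroness is required because 0 is its own formal inverse. *)
Definition units_in (F : fieldType) (S : {pred F}) : {pred F} :=
  [pred x | [&& x != 0, x \in S & x^-1 \in S]].

Section Rings.
Variables (F : fieldExtType rat) (z : F).
Implicit Types x y : F.

Lemma natr_neq0 N : (0 < N)%N -> N%:R != 0 :> F.
Proof.
move=> N0; have := fmorph_eq0 (in_alg F) (N%:R : rat).
by rewrite rmorph_nat pnatr_eq0 => ->; rewrite -lt0n.
Qed.

Lemma cycintP x :
  reflect (exists P : {poly int}, x = (map_poly intr P).[z]) (x \in cycint z).
Proof. exact: asboolP. Qed.

Fact cycint_subring : subring_closed (cycint z).
Proof.
split.
- by apply/cycintP; exists 1; rewrite rmorph1 hornerC.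
- move=> _ _ /cycintP[P ->] /cycintP[Q ->]; apply/cycintP; exists (P - Q).
  by rewrite rmorphB /= !hornerE.
- move=> _ _ /cycintP[P ->] /cycintP[Q ->]; apply/cycintP; exists (P * Q).
  by rewrite rmorphM /= hornerM.
Qed.
HB.instance Definition _ := GRing.isSubringClosed.Build F (cycint z) cycint_subring.

Lemma cycint_gen : z \in cycint z.
Proof. by apply/cycintP; exists 'X; rewrite map_polyX hornerX. Qed.

Lemma horner_int_cycint (P : {poly int}) x : x \in cycint z -> (map_poly intr P).[x] \in cycint z.
Proof.
move=> Ax; apply: rpred_horner => //; apply/polyOverP => i.
by rewrite coef_map rpred_int.
Qed.

Variable p : nat.

Lemma cyclocP x :
  reflect (exists2 N : nat, coprime p N & N%:R * x \in cycint z) (x \in cycloc p z).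
Proof. exact: asboolP. Qed.

Lemma cycint_loc x : x \in cycint z -> x \in cycloc p z.
Proof. by move=> Ax; apply/cyclocP; exists 1%N; rewrite ?coprimen1 ?mul1r. Qed.

Fact cycloc_subring : subring_closed (cycloc p z).
Proof.
split; first exact/cycint_loc/rpred1.
- move=> x y /cyclocP[N pN Nx] /cyclocP[M pM My]; apply/cyclocP.
  exists (N * M)%N; first by rewrite coprimeMr pN.
  rewrite mulrBr natrM -mulrA mulrCA -[_ * _ * y]mulrA.
  by rewrite rpredB // rpredM // ?rpred_nat.
- move=> x y /cyclocP[N pN Nx] /cyclocP[M pM My]; apply/cyclocP.
  exists (N * M)%N; first by rewrite coprimeMr pN.
  by rewrite natrM mulrACA rpredM.
Qed.
HB.instance Definition _ :=
  GRing.isSubringClosed.Build F (cycloc p z) cycloc_subring.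

Lemma cycloc_natV N : coprime p N -> (N%:R)^-1 \in cycloc p z.
Proof.
case: N => [_|N pN]; first by rewrite invr0 rpred0.
by apply/cyclocP; exists N.+1; rewrite ?divff ?rpred1 // natr_neq0.
Qed.

End Rings.

Section UnitsIn.
Variables (F : fieldType) (S : subringClosed F).

Lemma units_inP x : reflect [/\ x != 0, x \in S & x^-1 \in S] (x \in units_in S).
Proof. exact: and3P. Qed.

Fact units_in_div : sdivr_closed (units_in S).
Proof.
split.
  by apply/units_inP; rewrite invrN invr1 oppr_eq0 oner_eq0 rpredN rpred1.
move=> x y /units_inP[x0 Sx Sx'] /units_inP[y0 Sy Sy']; apply/units_inP.
by rewrite invfM invrK mulf_neq0 ?invr_eq0 ?rpredM.
Qed.
HB.instance Definition _ :=
  GRing.isSdivClosed.Build F (units_in S) units_in_div.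

Lemma units_in_sub x : x \in units_in S -> x \in S.
Proof. by case/units_inP. Qed.

Lemma units_in_subV x : x \in units_in S -> x^-1 \in S.
Proof. by case/units_inP. Qed.

Lemma units_in_neq0 x : x \in units_in S -> x != 0.
Proof. by case/units_inP. Qed.

End UnitsIn.

Section Cyclotomic.
Variables (F : fieldExtType rat) (n : nat) (z : F).
Hypothesis prim_z : n.-primitive_root z.

Local Notation d := (totient n).-1.
Local Notation A := (cycint z).

Lemma prim_root_neq0 : z != 0.
Proof.
apply: contra_eq_neq (prim_expr_order prim_z) => ->.
by rewrite expr0n gtn_eqF ?(prim_order_gt0 prim_z) // eq_sym oner_eq0.
Qed.

Lemma prim_root_invE : z^-1 = z ^+ n.-1.
Proof.
apply: (mulfI prim_root_neq0); rewrite divff ?prim_root_neq0 //.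
by rewrite -exprS prednK ?(prim_order_gt0 prim_z) // (prim_expr_order prim_z).
Qed.

Lemma prim_root_inv : n.-primitive_root z^-1.
Proof.
have n0 := prim_order_gt0 prim_z.
by rewrite prim_root_invE prim_root_exp_coprime // -{2}(prednK n0) coprimenS.
Qed.

Lemma cycint_inv : z^-1 \in A.
Proof. by rewrite prim_root_invE rpredX // cycint_gen. Qed.

(** By Euler's formula, the functional x |-> Tr(x / Phi_n'(z)). *)
Definition top_coord (x : F) : rat :=
  coord [tuple z ^+ i | i < (totient n).-1.+1] ord_max x.

Lemma totientS : d.+1 = totient n.
Proof. by rewrite prednK // totient_gt0 (prim_order_gt0 prim_z). Qed.

Lemma powers_free : free [tuple z ^+ i | i < d.+1].
Proof.
apply/freeP => k; under eq_bigr do rewrite (nth_map ord0) ?size_enum_ord // nth_ord_enum.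
move=> k0; pose q := \poly_(i < d.+1) k (inord i).
have q0 : q = 0.
  apply/eqP; apply: contraTT (size_poly d.+1 (fun i => k (inord i))) => qn0.
  rewrite -ltnNge -/q.
  have/dvdp_leq -/(_ qn0) : map_poly (intr : int -> rat) 'Phi_n %| q.
    apply: (Cyclotomic_min prim_z); rewrite rootE (horner_coef_wide (n := d.+1)).
      rewrite -[X in _ == X]k0; apply/eqP/eq_bigr => i _.
      by rewrite coef_map coef_poly ltn_ord inord_val /= mulr_algl.
    by rewrite size_map_poly size_poly.
  rewrite size_map_inj_poly ?size_Cyclotomic ?rmorph0 //; last exact: intr_inj.
  by rewrite totientS.
move=> i; have := coef0 rat i; rewrite -q0 coef_poly ltn_ord inord_val.
by [].
Qed.

Fact top_coord_scalar : scalar top_coord.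
Proof. by move=> a x y; rewrite /top_coord linearP. Qed.
HB.instance Definition _ := GRing.isLinear.Build rat F rat *%R top_coord top_coord_scalar.

Lemma top_coord_horner (P : {poly rat}) : (size P <= d.+1)%N ->
  top_coord (map_poly (in_alg F) P).[z] = P`_d.
Proof.
move=> sP; rewrite (horner_coef_wide (n := d.+1)) ?size_map_poly //.
rewrite /top_coord.
have -> : \sum_(i < d.+1) (map_poly (in_alg F) P)`_i * z ^+ i =
  \sum_(i < d.+1) P`_i *: [tuple z ^+ i | i < d.+1]`_i.
  apply: eq_bigr => i _.
  by rewrite (nth_map ord0) ?size_enum_ord // nth_ord_enum coef_map /= mulr_algl.
by rewrite coord_sum_free ?powers_free.
Qed.

Lemma top_coord_int x : x \in A -> top_coord x \is a Num.int.
Proof.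
case/cycintP=> P ->.
have monP := Cyclotomic_monic n.
rewrite {1}(Pdiv.RingMonic.rdivp_eq monP P) rmorphD rmorphM /=.
rewrite hornerD hornerM (rootP (Cyclotomic_root prim_z)) mulr0 add0r.
rewrite -map_poly_intr_in_alg top_coord_horner ?coef_map ?intr_int //.
rewrite size_map_inj_poly ?rmorph0 //; last exact: intr_inj.
have := Pdiv.Ring.ltn_rmodpN0 P (monic_neq0 monP).
by rewrite size_Cyclotomic ltnS -totientS.
Qed.

Hypothesis gen_z : rat_generated z.

Lemma cyc_denom (x : F) : exists2 M : nat, (0 < M)%N & M%:R * x \in A.
Proof.
have [P ->] := gen_z x; have [Q [c c0 ->]] := rat_poly_scale P.
exists `|c|%N; first by rewrite absz_gt0.
rewrite linearZ /= map_poly_intr_in_alg hornerZ.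
have -> : `|c|%:R = (-1) ^+ (c < 0)%R * in_alg F c%:~R :> F.
  by rewrite /= scaler_int {3}[c]intEsign rmorphM rmorph_sign /= signrMK.
rewrite -mulrA rpredM ?rpred_sign // mulrA -!in_algE -rmorphM.
rewrite divff ?intr_eq0 // rmorph1 mul1r.
by apply/cycintP; exists Q.
Qed.

(** The least M > 0 with M x in A is 1: a prime divisor p of M would give a
    smaller one, the gcd of M with a denominator of x prime to p. *)
Lemma cyc_locglob (x : F) : (forall p, prime p -> x \in cycloc p z) -> x \in A.
Proof.
move=> locx; have [M0 M00 AM0] := cyc_denom x.
have exM : exists M, (0 < M)%N && (M%:R * x \in A) by exists M0; rewrite M00.
have [M /andP[M_gt0 AM] Mmin] := ex_minnP exM.
suff M1 : M = 1%N by rewrite M1 mul1r in AM.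
apply/eqP; rewrite eqn_leq M_gt0 andbT leqNgt; apply/negP => M1.
have pM := pdiv_prime M1; have /cyclocP[N coN AN] := locx _ pM.
(* Bezout *)
have gA : (gcdn M N)%:R * x \in A.
  have [u v uv _] := egcdnP N M_gt0.
  have : (u * M)%:R * x - (v * N)%:R * x \in A.
    by rewrite !natrM -!mulrA rpredB // rpredM ?rpred_nat.
  by rewrite uv natrD mulrDl addrC addKr.
have /Mmin : (0 < gcdn M N)%N && ((gcdn M N)%:R * x \in A).
  by rewrite gA gcdn_gt0 M_gt0.
rewrite leqNgt => /negP; apply; rewrite ltn_neqAle dvdn_leq ?dvdn_gcdl // andbT.
apply: contraL coN => /eqP gM; rewrite prime_coprime // negbK.
by rewrite (dvdn_trans (pdiv_dvd M)) // -gM dvdn_gcdr.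
Qed.

(** The top coordinate of N / p z^d is N / p, whereas it is an integer on A. *)
Lemma invp_notin_loc p : prime p -> (p%:R : F)^-1 \notin cycloc p z.
Proof.
move=> pp; apply/negP => /cyclocP[N coN AN].
have /intrP[c] : (N%:R / p%:R : rat) \is a Num.int.
  have <- : top_coord (N%:R / p%:R * z ^+ d) = N%:R / p%:R.
    have -> : N%:R / p%:R * z ^+ d =
        (map_poly (in_alg F) ((N%:R / p%:R) *: 'X^d)).[z].
      by rewrite linearZ /= map_polyXn hornerZ hornerXn -!in_algE rmorphM fmorphV !rmorph_nat.
    rewrite top_coord_horner ?coefZ ?coefXn ?eqxx ?mulr1 //.
    by rewrite (leq_trans (size_scale_leq _ _)) ?size_polyXn.
  by rewrite top_coord_int // rpredM // rpredX ?cycint_gen.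
move/(canRL (divfK _)) => /(_ _)/wrap[|/eqP]; first by rewrite pnatr_eq0 -lt0n prime_gt0.
rewrite -[N%:R]/(N%:Z%:~R) -[p%:R]/(p%:Z%:~R) -rmorphM /= eqr_int => /eqP eN.
move: coN; rewrite prime_coprime // => /negP; apply.
by have := dvdz_mull c (dvdzz p%:Z); rewrite -eN.
Qed.

End Cyclotomic.

(** * Euler's dual frame *)

Lemma drop_poly_horner (R : comNzRingType) (f : {poly R}) (w : R) i :
  (drop_poly i f).[w] = f`_i + w * (drop_poly i.+1 f).[w].
Proof.
have -> : drop_poly i f = (f`_i)%:P + 'X * drop_poly i.+1 f.
  apply/polyP => -[|j]; rewrite coefD coefC coefXM !coef_drop_poly /=.
    by rewrite addr0.
  by rewrite add0r addnS.
by rewrite hornerD hornerC hornerM hornerX.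
Qed.

Lemma horner_quotient (R : comNzRingType) (f : {poly R}) (w : R) D :
  (size f <= D.+1)%N ->
  f = (\poly_(i < D) (drop_poly i.+1 f).[w]) * ('X - w%:P) + f.[w]%:P.
Proof.
move=> sf; set g := poly _ _.
have gE i : g`_i = (drop_poly i.+1 f).[w].
  rewrite coef_poly; case: ltnP => // Di.
  by rewrite drop_poly_eq0 ?horner0 // (leq_trans sf).
apply/polyP => -[|j]; rewrite coefD mulrBr coefB coefMX coefMC coefC !gE /=.
  have := drop_poly_horner f w 0; rewrite drop_poly0l => ->.
  by rewrite sub0r mulrC addrCA addNr addr0.
by rewrite addr0 drop_poly_horner mulrC addrK.
Qed.

Section DualFrame.
Variables (F : fieldExtType rat) (n : nat) (z : F).
Hypothesis prim_z : n.-primitive_root z.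
Hypothesis gen_z : rat_generated z.

Local Notation d := (totient n).-1.
Local Notation A := (cycint z).
Local Notation PhiF := (map_poly (intr : int -> F) 'Phi_n).
Local Notation tau := (top_coord n z).

(** The coefficient of X^i in the quotient of Phi_n by X - w. *)
Definition euler_coef (w : F) (i : nat) : F := (drop_poly i.+1 PhiF).[w].

Lemma size_PhiF : size PhiF = d.+2.
Proof.
rewrite (totientS prim_z) size_map_poly_id0 ?size_Cyclotomic //.
by rewrite (monicP (Cyclotomic_monic n)) rmorph1 oner_neq0.
Qed.

Lemma lead_PhiF : PhiF`_d.+1 = 1.
Proof.
have := lead_coef_map_id0 (f := (intr : int -> F)) (p := 'Phi_n).
rewrite (monicP (Cyclotomic_monic n)) rmorph1 rmorph0 oner_neq0.
by rewrite lead_coefE size_PhiF => ->.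
Qed.

Lemma euler_coef_top w : euler_coef w d = 1.
Proof.
rewrite /euler_coef drop_poly_horner lead_PhiF drop_poly_eq0 ?size_PhiF //.
by rewrite horner0 mulr0 addr0.
Qed.

Lemma euler_coef_int i : euler_coef z i \in A.
Proof.
apply/cycintP; exists (drop_poly i.+1 'Phi_n); congr (_.[_]).
by apply/polyP => j; rewrite coef_map !coef_drop_poly coef_map.
Qed.

(** Differentiate Phi_n = Q (X - z) + Phi_n(z) at z. *)
Lemma euler_sum_diag : \sum_(i < d.+1) z ^+ i * euler_coef z i = PhiF^`().[z].
Proof.
have := @horner_quotient F PhiF z d.+1; rewrite size_PhiF => /(_ (leqnn _)).
set g := poly _ _ => /(congr1 (fun P : {poly F} => P^`().[z])) ->.
rewrite !derivE !hornerE subrr mulr0 add0r horner_poly.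
by apply: eq_bigr => i _; rewrite mulrC.
Qed.

(** Evaluate Phi_n = Q (X - w) at z. *)
Lemma euler_sum_off w : root PhiF w -> w != z ->
  \sum_(i < d.+1) z ^+ i * euler_coef w i = 0.
Proof.
move=> rw wz.
have := @horner_quotient F PhiF w d.+1; rewrite size_PhiF => /(_ (leqnn _)).
set g := poly _ _ => /(congr1 (fun P : {poly F} => P.[z])).
rewrite (rootP (Cyclotomic_root prim_z)) (rootP rw) !hornerE => /esym/eqP.
rewrite mulf_eq0 subr_eq0 [z == w]eq_sym (negPf wz) orbF => /eqP g0.
by rewrite -[RHS]g0 horner_poly; apply: eq_bigr => i _; rewrite mulrC.
Qed.

Lemma tau_expr i : (i <= d)%N -> tau (z ^+ i) = (i == d)%:R.
Proof.
move=> id.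
have -> : z ^+ i = (map_poly (in_alg F) 'X^i).[z] by rewrite map_polyXn hornerXn.
by rewrite (top_coord_horner prim_z) ?coefXn ?size_polyXn 1?eq_sym.
Qed.

(** The right-hand side S commutes with multiplication by z, because the
    coefficients of the quotient satisfy z b_(i+1) = b_i - f_(i+1), and S 1 = 1;
    so it is the identity. *)
Lemma dual_frame x : x = \sum_(i < d.+1) tau (x * z ^+ i) *: euler_coef z i.
Proof.
pose S y := \sum_(i < d.+1) tau (y * z ^+ i) *: euler_coef z i.
have SZ a y : S (a *: y) = a *: S y.
  rewrite /S scaler_sumr; apply: eq_bigr => i _.
  by rewrite -scalerAl linearZ scalerA.
have SD y y' : S (y + y') = S y + S y'.
  rewrite /S -big_split; apply: eq_bigr => i _ /=.
  by rewrite mulrDl linearD scalerDl.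
have S1 : S 1 = 1.
  rewrite /S big_ord_recr /= mul1r tau_expr // eqxx scale1r euler_coef_top.
  rewrite big1 ?add0r // => i _; rewrite mul1r tau_expr ?ltn_eqF ?scale0r //.
  exact: ltnW.
have Sz y : S (y * z) = z * S y.
  have e0 : z * euler_coef z 0 = - PhiF`_0.
    have := rootP (Cyclotomic_root prim_z); rewrite -{1}[PhiF]drop_poly0l.
    by rewrite drop_poly_horner => /eqP; rewrite addrC addr_eq0 => /eqP.
  (* the recursion of synthetic division *)
  have eS i : z * euler_coef z i.+1 = euler_coef z i - PhiF`_i.+1.
    by rewrite /euler_coef (drop_poly_horner _ _ i.+1) addrC addKr.
  have sumPhi : \sum_(i < d.+1) PhiF`_i * z ^+ i = - z ^+ d.+1.
    have := rootP (Cyclotomic_root prim_z).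
    rewrite (horner_coef_wide (n := d.+2)) ?size_PhiF // big_ord_recr /=.
    by rewrite lead_PhiF mul1r => /eqP; rewrite addr_eq0 => /eqP.
  have tauPhi : \sum_(i < d.+1) tau (y * z ^+ i) *: PhiF`_i = - (tau (y * z ^+ d.+1))%:A.
    transitivity ((tau (\sum_(i < d.+1) y * (PhiF`_i * z ^+ i)))%:A : F).
      rewrite linear_sum /= scaler_suml; apply: eq_bigr => i _.
      rewrite coef_map /= -scaler_int.
      rewrite -scalerAl mul1r -scalerAr scalerA mulrC.
      by rewrite [in RHS]linearZ.
    by rewrite -mulr_sumr sumPhi mulrN linearN scaleNr.
  rewrite /S big_ord_recr /= euler_coef_top mulr_sumr -mulrA -exprS.
  have -> : \sum_(i < d.+1) z * (tau (y * z ^+ i) *: euler_coef z i) =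
    \sum_(i < d) tau (y * z ^+ i.+1) *: euler_coef z i
    - \sum_(i < d.+1) tau (y * z ^+ i) *: PhiF`_i.
    rewrite big_ord_recl [in X in _ - X]big_ord_recl /= opprD addrCA.
    rewrite -sumrB -scalerAr e0 scalerN; congr (_ + _).
    by apply: eq_bigr => i _; rewrite -scalerAr eS scalerBr.
  rewrite tauPhi opprK; congr (_ + _); apply: eq_bigr => i _.
  by rewrite -mulrA -exprS.
have [P ->] := gen_z x; rewrite -/(S _).
elim/poly_ind: P => [|P c IH].
  by rewrite rmorph0 horner0 /S big1 // => i _; rewrite mul0r linear0 scale0r.
rewrite rmorphD rmorphM /= map_polyX map_polyC /= hornerMXaddC SD Sz -IH SZ S1.
by rewrite mulrC.
Qed.

(** The dual frame has integral coefficients. *)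
Lemma cycint_dual x : (forall a, a \in A -> tau (x * a) \is a Num.int) -> x \in A.
Proof.
move=> xdual; rewrite [x]dual_frame rpred_sum // => i _.
have /intrP[c ->] := xdual _ (rpredX i (cycint_gen z)).
by rewrite scaler_int rpredMz // euler_coef_int.
Qed.

Lemma cycloc_denom p c N x : prime p -> x \in cycloc p z ->
  (p ^ c * N)%:R * x \in A -> N%:R * x \in A.
Proof.
move=> pp /cyclocP[M coM AM] AN.
have p_gt0 : (0 < p ^ c)%N by rewrite expn_gt0 prime_gt0.
have [u v uv _] := egcdnP M p_gt0.
have : gcdn (p ^ c) M = 1%N by apply/eqP; rewrite -/(coprime _ _) coprimeXl.
move=> g1; rewrite {}g1 in uv.
have -> : N%:R * x = u%:R * ((p ^ c * N)%:R * x) - (v * N)%:R * (M%:R * x).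
  rewrite !mulrA -!natrM !mulnA uv -mulrBl mulnAC mulnDl mul1n natrD.
  by rewrite addrC addKr.
by rewrite rpredB // rpredM ?rpred_nat.
Qed.

End DualFrame.

(** * Frobenius and local uniformizers *)

Section LocalUniformizer.
Variables (F : fieldExtType rat) (n : nat) (z : F).
Hypothesis prim_z : n.-primitive_root z.
Hypothesis gen_z : rat_generated z.

Local Notation A := (cycint z).
Local Notation Aloc p := (cycloc p z).

Section Frobenius.
Variables (p : nat).
Hypothesis pr_p : prime p.

(** The inner binomial coefficients are divisible by p. *)
Lemma exp_prime_add_cong x y : x \in A -> y \in A ->
  ((x + y) ^+ p - (x ^+ p + y ^+ p)) / p%:R \in A.
Proof.
move=> Ax Ay; have p0 := prime_gt0 pr_p; rewrite -(prednK p0).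
rewrite exprDn big_ord_recl big_ord_recr /= bin0 binn subn0 subnn !expr0.
have E (X Y S : F) : X + (S + Y) - (X + Y) = S by ring.
rewrite mulr1 mul1r !mulr1n E.
rewrite mulr_suml rpred_sum // => i _; rewrite /bump leq0n add1n prednK //.
have /dvdnP[c ->] : (p %| 'C(p, i.+1))%N.
  by rewrite prime_dvd_bin //= -ltn_predRL ltn_ord.
rewrite mulrnA -[_ *+ p]mulr_natr mulfK ?natr_neq0 //.
by rewrite rpredMn // rpredM // rpredX.
Qed.

Lemma fermat_int (c : int) : ((c ^+ p - c)%:~R / p%:R : F) \in A.
Proof.
have : (p%:Z %| c ^+ p - c)%Z.
  rewrite (dvdz_pcharf (pchar_Fp pr_p)) rmorphB rmorphXn /= subr_eq0.
  by rewrite -[X in _ ^+ X](card_Fp pr_p) expf_card.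
by case/dvdzP=> k ->; rewrite rmorphM /= mulfK ?rpred_int // natr_neq0 ?prime_gt0.
Qed.

(** The p-th power map is additive mod p and, by Fermat, fixes coefficients. *)
Lemma frobenius_horner (P : {poly int}) w : w \in A ->
  ((map_poly intr P).[w] ^+ p - (map_poly intr P).[w ^+ p]) / p%:R \in A.
Proof.
move=> Aw; elim/poly_ind: P => [|P c IH].
  by rewrite rmorph0 !horner0 expr0n gtn_eqF ?prime_gt0 //= subrr mul0r rpred0.
rewrite rmorphD rmorphM /= map_polyX map_polyC /= !hornerMXaddC.
set u := (map_poly intr P).[w] in IH *; set v := (map_poly intr P).[w ^+ p] in IH *.
have -> : (u * w + c%:~R) ^+ p - (v * w ^+ p + c%:~R) =
   ((u * w + c%:~R) ^+ p - ((u * w) ^+ p + c%:~R ^+ p))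
    + w ^+ p * (u ^+ p - v) + (c ^+ p - c)%:~R.
  rewrite rmorphB rmorphXn /= exprMn.
  have E (t a b v' c' e : F) : t - (v' * b + c') =
    t - (a * b + e) + b * (a - v') + (e - c') by ring.
  exact: E.
rewrite mulrDl rpredD ?fermat_int // mulrDl rpredD //.
  by rewrite exp_prime_add_cong ?rpred_int // rpredM // horner_int_cycint.
by rewrite -mulrA rpredM // rpredX.
Qed.

Lemma frobenius_iter (P : {poly int}) k :
  ((map_poly intr P).[z] ^+ (p ^ k) - (map_poly intr P).[z ^+ (p ^ k)]) / p%:R \in A.
Proof.
have Az := cycint_gen z.
elim: k => [|k IH]; first by rewrite expn0 !expr1 subrr mul0r rpred0.
rewrite expnSr !exprM.
set u := (map_poly intr P).[z] ^+ (p ^ k) in IH *; set w := z ^+ (p ^ k) in IH *.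
have Aw : w \in A by rewrite rpredX.
rewrite -[_ - _](subrKA ((map_poly intr P).[w] ^+ p)) mulrDl.
rewrite rpredD ?frobenius_horner // subrXX mulrAC rpredM // rpred_sum // => i _.
by rewrite rpredM // rpredX // ?horner_int_cycint // rpredX // horner_int_cycint.
Qed.

(** With q = p^phi(m), m divides q - 1, so 1 - z^m, hence pi, divides z^q - z,
    and P(z)^q = P(z^q) = P(z) mod pi. *)
Lemma frobenius_cong m pi : coprime p m ->
    p%:R / pi \in A -> (1 - z ^+ m) / pi \in A ->
  exists2 q, (1 < q)%N & forall a, a \in A -> (a ^+ q - a) / pi \in A.
Proof.
move=> co_pm Ap Am; have Az := cycint_gen z.
have p1 := prime_gt1 pr_p.
have m0 : (0 < m)%N.
  by case: m co_pm {Am} => //; rewrite /coprime gcdn0 => /eqP p1'; rewrite p1' in p1.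
exists (p ^ totient m)%N => [|a].
  by rewrite -{1}(exp1n (totient m)) ltn_exp2r // totient_gt0.
case/cycintP=> P ->; set q := (p ^ _)%N.
have q0 : (0 < q)%N by rewrite expn_gt0 prime_gt0.
have /dvdnP[j qj] : (m %| q.-1)%N.
  by rewrite -subn1 -eqn_mod_dvd //; apply/eqP/Euler_exp_totient.
have zq : (z ^+ q - z) / pi \in A.
  rewrite -(prednK q0) qj exprS mulnC exprM -[X in _ - X]mulr1 -mulrBr -mulrA rpredM //.
  rewrite -opprB mulNr rpredN -{1}[1](expr1n _ j) subrXX mulrAC rpredM //.
  by rewrite rpred_sum // => i _; rewrite rpredM ?rpredX ?rpred1.
rewrite -[_ - _](subrKA ((map_poly intr P).[z ^+ q])) mulrDl rpredD //.
  rewrite -[X in X / _](divfK (natr_neq0 F (prime_gt0 pr_p))) -[X in X \in _]mulrA rpredM //.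
  exact: frobenius_iter.
elim/poly_ind: P => [|P c IH]; first by rewrite rmorph0 !horner0 subrr mul0r rpred0.
rewrite rmorphD rmorphM /= map_polyX map_polyC /= !hornerMXaddC.
set u := (map_poly intr P).[_] in IH *; set v := (map_poly intr P).[z] in IH *.
have Av : v \in A by apply/cycintP; exists P.
have -> : u * z ^+ q + c%:~R - (v * z + c%:~R) = z ^+ q * (u - v) + v * (z ^+ q - z).
  by set t := z ^+ q; set cc := c%:~R; ring.
by rewrite mulrDl -!mulrA rpredD // rpredM // rpredX.
Qed.

End Frobenius.

(** What is kept of a uniformizer at p with ramification index e: it is an
    associate of an e-th root of p in A_p, and A / pi is reduced since it is
    fixed by a power map. *)
Definition uniformizer p pi e :=
  [/\ prime p, pi \in A /\ pi != 0, (0 < e)%N, p%:R / pi ^+ e \in units_in (Aloc p)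
    & exists2 q, (1 < q)%N & forall a, a \in A -> (a ^+ q - a) / pi \in A].

Section Local.
Variables (p e : nat) (pi : F).
Hypothesis unif : uniformizer p pi e.

Let pr_p : prime p. Proof. by case: unif. Qed.
Let Api : pi \in Aloc p. Proof. by case: unif => _ [/cycint_loc]. Qed.
Let pi0 : pi != 0. Proof. by case: unif => _ []. Qed.

Lemma unif_inv_notin : pi^-1 \notin Aloc p.
Proof.
apply/negP => Vpi; have /negP[] := invp_notin_loc prim_z pr_p.
have [_ _ _ /units_in_subV Up _] := unif.
have := rpredM Up (rpredX e Vpi).
by rewrite exprVn invf_div mulrAC divff ?mul1r // expf_neq0.
Qed.

Lemma unif_frobenius a k : a \in A ->
  exists2 q, (k < q)%N & (a ^+ q - a) / pi \in A.
Proof.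
have [_ _ _ _ [q q1 qA]] := unif => Aa.
exists (q ^ k)%N; first exact: ltn_expl.
elim: k => [|k IH]; first by rewrite expr1 subrr mul0r rpred0.
rewrite expnSr exprM -[_ - _](subrKA (a ^+ (q ^ k))) mulrDl rpredD //.
by rewrite qA // rpredX.
Qed.

(** The quotient A_p / pi is reduced: a = a^q mod pi for some q > k. *)
Lemma unif_reduced a k : a \in Aloc p ->
  a ^+ k / pi \in Aloc p -> a / pi \in Aloc p.
Proof.
case/cyclocP => N coN AN ak.
have [q kq Aq] := unif_frobenius k AN.
have N0 : (0 < N)%N.
  case: N coN {AN Aq} => //; rewrite /coprime gcdn0 => /eqP p1.
  by have := prime_gt1 pr_p; rewrite p1.
suff : (N%:R * a) / pi \in Aloc p.
  move=> /(rpredM (cycloc_natV z coN)).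
  by rewrite !mulrA mulVf ?mul1r ?natr_neq0.
have -> : N%:R * a / pi = (N%:R * a) ^+ q / pi - ((N%:R * a) ^+ q - N%:R * a) / pi.
  by rewrite -mulrBl opprB addrCA subrr addr0.
rewrite rpredB ?(cycint_loc _ Aq) //.
rewrite -(subnK (ltnW kq)) exprD -mulrA rpredM ?rpredX ?(cycint_loc _ AN) //.
by rewrite exprMn -mulrA rpredM // rpredX // rpred_nat.
Qed.

(** Every element of F is some pi^(-j) times an element of A_p, so a statement of
    this kind follows by lowering j. *)
Lemma unif_descent x :
  (forall j, pi ^+ j.+1 * x \in Aloc p -> pi ^+ j * x \in Aloc p) -> x \in Aloc p.
Proof.
move=> desc; suff [j Aj] : exists j, pi ^+ j * x \in Aloc p.
  by elim: j Aj => [|j IH]; [rewrite mul1r | move/desc].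
have [M M0 AM] := cyc_denom gen_z x.
have [N coN MN] := pfactor_coprime pr_p M0; set c := logn p M in MN.
exists (e * c)%N; have [_ _ _ /units_in_subV Up _] := unif.
have p0 := natr_neq0 F (prime_gt0 pr_p).
have pc0 : p%:R ^+ c != 0 :> F by rewrite expf_neq0.
have -> : pi ^+ (e * c) * x =
    (p%:R / pi ^+ e)^-1 ^+ c * (N%:R^-1 * (M%:R * x)).
  have N0 : N%:R != 0 :> F.
    by apply: natr_neq0; case: N MN {coN} => // M0'; rewrite M0' in M0.
  rewrite invf_div expr_div_n -exprM MN natrM natrX; field.
  by rewrite N0 pc0.
by rewrite rpredM ?rpredX // rpredM ?cycloc_natV // cycint_loc.
Qed.

Let unif_shift j x : pi ^+ j * x = pi ^+ j.+1 * x / pi.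
Proof. by apply: (mulIf pi0); rewrite divfK // (exprS pi j) mulrC mulrA. Qed.

(** The substitute for v(y) >= -1/2 implies v(y) >= 0. *)
Lemma unif_root_closed y : pi * y ^+ 2 \in Aloc p -> y \in Aloc p.
Proof.
move=> Ay; apply: unif_descent => j Aj.
rewrite unif_shift.
apply: (unif_reduced (k := 2)) => //.
have -> : (pi ^+ j.+1 * y) ^+ 2 / pi = pi ^+ j.*2 * (pi * y ^+ 2).
  rewrite exprMn -exprM muln2 doubleS !exprS; field; exact: pi0.
by rewrite rpredM // rpredX.
Qed.

Lemma unif_sqrt_unit y : y ^+ 2 \in units_in (Aloc p) -> y \in units_in (Aloc p).
Proof.
case/units_inP => y0 Ay Ay'; rewrite sqrf_eq0 in y0; apply/units_inP.
by split=> //; apply: unif_root_closed; rewrite rpredM // exprVn.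
Qed.

(** If a = pi^(j+1) x is in A_p, the integral equation of x makes a power of a
    divisible by pi. *)
Lemma unif_integral x : integralOver (intr : int -> F) x -> x \in Aloc p.
Proof.
case=> P monP rootP; apply: unif_descent => j Aj.
rewrite unif_shift.
set D := (size P).-1.
have sP : size P = D.+1.
  by rewrite prednK // lt0n size_poly_eq0 monic_neq0.
have xD : x ^+ D = - \sum_(i < D) (P`_i)%:~R * x ^+ i.
  move: rootP; rewrite rootE (horner_coef_wide (n := D.+1)); last first.
    by rewrite -sP size_poly.
  rewrite big_ord_recr /= coef_map /= -[P`_D]/(lead_coef P) (monicP monP) mul1r.
  rewrite addrC addr_eq0 => /eqP ->; congr (- _).
  by apply: eq_bigr => i _; rewrite coef_map.
apply: (unif_reduced (k := D)) => //.
rewrite exprMn xD mulrN mulNr rpredN mulr_sumr mulr_suml rpred_sum // => i _.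
have -> : (pi ^+ j.+1) ^+ D * ((P`_i)%:~R * x ^+ i) / pi =
   (P`_i)%:~R * pi ^+ (j + j.+1 * (D - i).-1) * (pi ^+ j.+1 * x) ^+ i.
  have iD : (0 < D - i)%N by rewrite subn_gt0.
  rewrite -{1}(subnK (ltnW (ltn_ord i))) -{1}(prednK iD) -exprM mulnDr mulnS.
  rewrite addSn addSn exprS exprMn -exprM !exprD.
  set u := x ^+ i; set v := (_)%:~R; set t := pi ^+ (_ * i).
  by set w := pi ^+ j; set r := pi ^+ _; field.
by rewrite !rpredM ?rpredX ?rpred_int.
Qed.

End Local.
End LocalUniformizer.

(** * Uniformizers of a cyclotomic field and its different *)

Section RootsOfUnity.
Variables (F : fieldExtType rat).

Lemma one_sub_prim_neq0 (k : nat) (w : F) : (1 < k)%N -> k.-primitive_root w -> 1 - w != 0.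
Proof.
move=> k1 pw; rewrite subr_eq0 eq_sym -[w]expr1 -(prim_order_dvd pw).
by rewrite dvdn1 gtn_eqF.
Qed.

Lemma prod_one_sub_prim (k : nat) (w : F) : k.-primitive_root w ->
  \prod_(i < k.-1) (1 - w ^+ i.+1) = k%:R.
Proof.
move=> pw; have k0 := prim_order_gt0 pw; have := factor_Xn_sub_1 pw.
case: k k0 pw => // k _ pw /=.
rewrite big_nat_recl // expr0 big_mkord subrX1 => /mulfI-/(_ (monic_neq0 (monicXsubC _))).
move=> /(congr1 (fun P : {poly F} => P.[1])); rewrite horner_prod horner_sum.
under eq_bigr do rewrite !hornerE. move=> ->.
under eq_bigr do rewrite hornerXn expr1n.
by rewrite sumr_const card_ord.
Qed.

(** The factorization of X^k - 1 at 1 / y, times y^k. *)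
Lemma one_sub_expr_prod (k : nat) (w y : F) : k.-primitive_root w -> y != 0 ->
  1 - y ^+ k = \prod_(i < k) (1 - y * w ^+ i).
Proof.
move=> pw y0; have := factor_Xn_sub_1 pw.
move=> /(congr1 (fun P : {poly F} => P.[y^-1])).
rewrite horner_prod big_mkord !hornerE => e.
transitivity (y ^+ k * (y^-1 ^+ k - 1)).
  by rewrite mulrBr mulr1 exprVn divff // expf_neq0.
rewrite -e -[X in _ ^+ X]card_ord -prodr_const -big_split /=.
by apply: eq_bigr => i _; rewrite !hornerE mulrBr divff.
Qed.

Variable z : F.
Local Notation A := (cycint z).

(** Cyclotomic units: 1 - w divides 1 - w^j, and w is itself a power of w^j. *)
Lemma one_sub_expr_unit (k j : nat) (w : F) : w \in A -> (1 < k)%N ->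
  k.-primitive_root w -> coprime k j -> (1 - w ^+ j) / (1 - w) \in units_in A.
Proof.
move=> Aw k1 pw co.
have dvd (v : F) i : v \in A -> 1 - v != 0 -> (1 - v ^+ i) / (1 - v) \in A.
  move=> Av v1; rewrite -{1}[1](expr1n _ i) subrXX mulrAC divff // mul1r.
  by rewrite rpred_sum // => ? _; rewrite rpredM ?rpredX ?rpred1.
have pwj : k.-primitive_root (w ^+ j) by rewrite prim_root_exp_coprime // coprime_sym.
have n1 := one_sub_prim_neq0 k1 pw; have nj := one_sub_prim_neq0 k1 pwj.
apply/units_inP; split; rewrite ?mulf_neq0 ?invr_eq0 ?dvd //.
rewrite invf_div.
have j0 : (0 < j)%N by case: j co {pwj nj} => //; rewrite /coprime gcdn0 gtn_eqF.
have [u v uv _] := egcdnP k j0.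
have {1}-> : w = (w ^+ j) ^+ u.
  have g1 : gcdn j k = 1%N by rewrite gcdnC; apply/eqP.
  by rewrite -exprM mulnC uv g1 addn1 exprS mulnC exprM (prim_expr_order pw) expr1n mulr1.
by rewrite dvd // rpredX.
Qed.

Lemma units_in_loc p x : x \in units_in A -> x \in units_in (cycloc p z).
Proof. by case/units_inP => x0 Ax Ax'; apply/units_inP; rewrite !cycint_loc. Qed.

Lemma units_in_prodl p x y : x * y \in units_in (cycloc p z) ->
  x \in cycloc p z -> y \in cycloc p z -> x \in units_in (cycloc p z).
Proof.
case/units_inP; rewrite mulf_eq0 => /norP[x0 y0] _ xyV Ax Ay.
apply/units_inP; split=> //; suff -> : x^-1 = y * (x * y)^-1 by rewrite rpredM.
by rewrite invfM mulrCA divff // mulr1.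
Qed.

Lemma units_in_nat p k : (0 < k)%N -> coprime p k -> k%:R \in units_in (cycloc p z).
Proof.
move=> k0 co; apply/units_inP.
by rewrite natr_neq0 // rpred_nat cycloc_natV.
Qed.

End RootsOfUnity.

Section ExplicitUniformizers.
Variables (F : fieldExtType rat) (n : nat) (z : F).
Hypothesis prim_z : n.-primitive_root z.
Local Notation A := (cycint z).
Local Notation Aloc p := (cycloc p z).
Local Notation PhiF := (map_poly (intr : int -> F) 'Phi_n).

Let n_gt0 : (0 < n)%N := prim_order_gt0 prim_z.
Let Az : z \in A := cycint_gen z.
Let z_neq0 := prim_root_neq0 prim_z.
Let Az' := cycint_inv prim_z.

Lemma uniformizer_unram p : prime p -> ~~ (p %| n)%N -> uniformizer z p p%:R 1.
Proof.
move=> pp pn; have p0 := natr_neq0 F (prime_gt0 pp).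
split=> //; first by rewrite rpred_nat.
  by rewrite expr1 divff // rpred1.
apply: (frobenius_cong pp (m := n)); rewrite ?prime_coprime ?divff ?rpred1 //.
by rewrite (prim_expr_order prim_z) subrr mul0r rpred0.
Qed.

(** Here [z ^+ n`_p^'] is a root of unity of order the p-part of n. *)
Definition ramif_unif p : F := 1 - z ^+ (n`_p^')%N.
(** The ramification index of p in F is [ramif_exp p * p.-1]. *)
Definition ramif_exp p := (p ^ (logn p n).-1)%N.

Section Ramified.
Variable p : nat.
Hypotheses (pr_p : prime p) (p_n : (p %| n)%N).

Let r_gt0 : (0 < logn p n)%N. Proof. by rewrite logn_gt0 mem_primes pr_p n_gt0. Qed.

Lemma prim_root_ppart : (p ^ logn p n).-primitive_root (z ^+ (n`_p^')%N).
Proof.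
have -> : (n`_p^')%N = (n %/ p ^ logn p n)%N by rewrite -p_part -{2}(partnC p n_gt0) mulKn.
by apply: dvdn_prim_root => //; exact: pfactor_dvdnn.
Qed.

Lemma prim_root_p : p.-primitive_root (z ^+ (n %/ p)).
Proof. exact: dvdn_prim_root. Qed.

Lemma ramif_unif_neq0 : ramif_unif p != 0.
Proof.
apply: one_sub_prim_neq0 prim_root_ppart.
by rewrite -(exp1n (logn p n)) ltn_exp2r // prime_gt1.
Qed.

(** With E = p^(r-1) and w of order p^r, 1 - w^E is the product over t < E of the
    1 - w^(1 + p t), all associate to 1 - w. *)
Lemma ramif_unif_prim : (1 - z ^+ (n %/ p)) / ramif_unif p ^+ ramif_exp p \in units_in A.
Proof.
rewrite /ramif_unif; set w := z ^+ (n`_p^')%N.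
have pw : (p ^ logn p n).-primitive_root w := prim_root_ppart.
have np : (n %/ p)%N = ((n`_p^')%N * ramif_exp p)%N.
  rewrite -{1}(partnC p n_gt0) p_part -(prednK r_gt0) expnS -mulnA mulKn ?prime_gt0 //.
  by rewrite mulnC.
have pxi : (ramif_exp p).-primitive_root (w ^+ p).
  have eqp : (p ^ logn p n %/ ramif_exp p)%N = p.
    by rewrite /ramif_exp -{1}(prednK r_gt0) expnS mulnK // expn_gt0 prime_gt0.
  by rewrite -{2}eqp; apply: dvdn_prim_root => //; rewrite dvdn_exp2l // leq_pred.
rewrite np exprM -/w (one_sub_expr_prod pxi) ?expf_neq0 //.
rewrite -[X in _ / _ ^+ X]card_ord -prodr_const -prodf_div rpred_prod // => i _.
rewrite -exprM -exprS; apply: one_sub_expr_unit pw _; rewrite ?rpredX //.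
  by rewrite -(exp1n (logn p n)) ltn_exp2r // prime_gt1.
rewrite coprimeXl // prime_coprime // -addn1 dvdn_addr ?dvdn_mulr //.
by rewrite dvdn1 gtn_eqF ?prime_gt1.
Qed.

Lemma ramif_unif_p : p%:R / ramif_unif p ^+ (ramif_exp p * p.-1) \in units_in A.
Proof.
have p1 := prime_gt1 pr_p.
have v0 := one_sub_prim_neq0 p1 prim_root_p.
suff pv : p%:R / (1 - z ^+ (n %/ p)) ^+ p.-1 \in units_in A.
  have := rpredM pv (rpredX p.-1 ramif_unif_prim).
  by rewrite expr_div_n mulrA divfK ?expf_neq0 // -exprM.
rewrite -(prod_one_sub_prim prim_root_p) -[X in _ / _ ^+ X]card_ord -prodr_const.
rewrite -prodf_div rpred_prod // => i _.
apply: one_sub_expr_unit p1 prim_root_p _; rewrite ?rpredX //.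
by rewrite prime_coprime // gtnNdvd // -ltn_predRL ltn_ord.
Qed.

Lemma uniformizer_ram : uniformizer z p (ramif_unif p) (ramif_exp p * p.-1).
Proof.
have p1 := prime_gt1 pr_p.
have ex0 : (0 < ramif_exp p * p.-1)%N.
  by rewrite muln_gt0 expn_gt0 prime_gt0 //= -subn1 subn_gt0.
split=> //.
- by rewrite rpredB ?rpred1 ?rpredX // ramif_unif_neq0.
- exact/units_in_loc/ramif_unif_p.
apply: (frobenius_cong pr_p (m := (n`_p^')%N)).
- by rewrite prime_coprime // -p'natE // part_pnat.
- have := units_in_sub ramif_unif_p; rewrite -{1}(prednK ex0) exprS invfM mulrA.
  move=> Au; have := rpredM Au (_ : ramif_unif p ^+ (ramif_exp p * p.-1).-1 \in A).
  rewrite divfK ?expf_neq0 ?ramif_unif_neq0 //; apply.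
  by rewrite rpredX // rpredB ?rpred1 ?rpredX.
- by rewrite divff ?rpred1 // ramif_unif_neq0.
Qed.

End Ramified.

Lemma deriv_cofactor (f H : {poly F}) : f * H = 'X^n - 1 -> root f z ->
  f^`().[z] * H.[z] = n%:R * z ^+ n.-1.
Proof.
move=> fH rf; have := congr1 (fun P : {poly F} => P^`().[z]) fH.
rewrite derivM derivB derivXn derivC subr0 hornerD !hornerM (rootP rf) mul0r addr0 => ->.
by rewrite hornerMn hornerXn mulr_natl.
Qed.

(** Phi_n'(z) divides n z^(n-1), the derivative of X^n - 1 at z. *)
Lemma deriv_Phi_unram p : prime p -> ~~ (p %| n)%N -> PhiF^`().[z] \in units_in (Aloc p).
Proof.
move=> pp pn; have e : 'Phi_n * \prod_(d <- rem n (divisors n)) 'Phi_d = 'X^n - 1.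
  by rewrite -(prod_Cyclotomic n_gt0) [RHS](big_rem n) ?divisors_id.
move/(congr1 (map_poly (intr : int -> F))): e.
rewrite rmorphM rmorphB rmorph1 /= map_polyXn.
move/deriv_cofactor => /(_ (Cyclotomic_root prim_z)) e.
apply: (@units_in_prodl _ _ _ _
  (map_poly intr (\prod_(d <- rem n (divisors n)) 'Phi_d)).[z]); last 2 first.
- by apply: cycint_loc; rewrite deriv_map horner_int_cycint.
- by apply: cycint_loc; rewrite horner_int_cycint.
rewrite e rpredM ?rpredX //.
  by rewrite units_in_nat // prime_coprime.
by apply: units_in_loc; apply/units_inP.
Qed.

(** Here c = n / d is prime to p and z^d has order c, so Phi_d(z) divides
    z^d - 1, which divides c. *)
Lemma Cyclotomic_horner_unit p d : prime p -> (p %| n)%N ->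
    d \in divisors n -> ~~ (d %| n %/ p)%N -> d != n ->
  (map_poly intr 'Phi_d).[z] \in units_in (Aloc p).
Proof.
move=> pp pn; rewrite -dvdn_divisors // => dn ndp nd.
have d0 : (0 < d)%N := dvdn_gt0 n_gt0 dn.
have [c nE] := dvdnP dn.
have c0 : (0 < c)%N by move: n_gt0; rewrite nE muln_gt0 => /andP[].
have c1 : (1 < c)%N.
  by rewrite ltn_neqAle c0 andbT eq_sym; apply: contraNneq nd => c1; rewrite nE c1 mul1n.
have pc : coprime p c.
  rewrite prime_coprime //; apply: contraNN ndp => /dvdnP[k ck].
  by rewrite nE ck mulnAC mulnK ?prime_gt0 // dvdn_mull.
have pzd : c.-primitive_root (z ^+ d).
  have -> : d = (n %/ c)%N by rewrite nE mulKn.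
  by apply: dvdn_prim_root => //; rewrite nE dvdn_mulr.
have A1 : 1 - z ^+ d \in A by rewrite rpredB ?rpred1 ?rpredX.
have U1 : z ^+ d - 1 \in units_in (Aloc p).
  rewrite -opprB rpredN; have := units_in_nat z c0 pc.
  rewrite -(prod_one_sub_prim pzd).
  case: c c1 {nE c0 pc pzd} => [//|[//|c]] _ /=; rewrite big_ord_recl expr1.
  move/units_in_prodl; apply; apply: cycint_loc => //.
  by rewrite rpred_prod // => i _; rewrite rpredB ?rpred1 ?rpredX.
move: U1; have -> : z ^+ d - 1 =
   (map_poly intr 'Phi_d).[z] * (map_poly intr (\prod_(d' <- rem d (divisors d)) 'Phi_d')).[z].
  have e : 'X^d - 1 = 'Phi_d * \prod_(d' <- rem d (divisors d)) 'Phi_d'.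
    by rewrite -(prod_Cyclotomic d0) [LHS](big_rem d) ?divisors_id.
  by rewrite -hornerM -rmorphM -e rmorphB rmorph1 /= map_polyXn !hornerE.
by move/units_in_prodl; apply; apply: cycint_loc; rewrite horner_int_cycint.
Qed.

(** In X^n - 1 = Phi_n (X^(n/p) - 1) R, the factor R gathers the other Phi_d with d
    of full exponent at p, whose values at z are units at p. Differentiating at z
    gives n z^(n-1) = Phi_n'(z) (z^(n/p) - 1) R(z), with n ~ pi^(r e) and
    z^(n/p) - 1 ~ pi^(p^(r-1)). *)
Lemma deriv_Phi_ram p : prime p -> (p %| n)%N ->
  PhiF^`().[z] / ramif_unif p ^+ (logn p n * (ramif_exp p * p.-1) - ramif_exp p)
    \in units_in (Aloc p).
Proof.
move=> pp pn; set s := (_ - _)%N.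
have p1 := prime_gt1 pp.
have r0 : (0 < logn p n)%N by rewrite logn_gt0 mem_primes pp n_gt0.
have np0 : (0 < n %/ p)%N by rewrite divn_gt0 ?prime_gt0 // dvdn_leq.
(* the divisors of n that do not divide n / p are those of full exponent at p *)
pose R := \prod_(d <- rem n [seq d <- divisors n | ~~ (d %| n %/ p)%N]) 'Phi_d.
have e : 'Phi_n * (('X^(n %/ p) - 1) * R) = 'X^n - 1.
  rewrite mulrCA -(prod_Cyclotomic n_gt0) [RHS](bigID (fun d => d %| n %/ p)%N) /=.
  congr (_ * _).
    rewrite -(prod_Cyclotomic np0) -[RHS]big_filter; apply: perm_big.
    apply: uniq_perm; rewrite ?filter_uniq ?divisors_uniq // => d.
    rewrite mem_filter -!dvdn_divisors //.
    by apply/idP/andP => [dnp|[]//]; split=> //; apply: dvdn_trans dnp (dvdn_div _).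
  rewrite -big_filter [RHS](big_rem n) // mem_filter divisors_id // andbT.
  by rewrite gtnNdvd // ltn_Pdiv.
have eu : PhiF^`().[z] * ((z ^+ (n %/ p) - 1) * (map_poly intr R).[z]) = n%:R * z ^+ n.-1.
  move/(congr1 (map_poly (intr : int -> F))): e.
  rewrite !rmorphM !rmorphB rmorph1 /= !map_polyXn.
  move/deriv_cofactor => /(_ (Cyclotomic_root prim_z)).
  by rewrite !hornerE.
have UR : (map_poly intr R).[z] \in units_in (Aloc p).
  rewrite rmorph_prod horner_prod big_seq rpred_prod // => d.
  rewrite rem_filter ?filter_uniq ?divisors_uniq // mem_filter /= => /andP[dn].
  by rewrite mem_filter => /andP[dp dd]; apply: Cyclotomic_horner_unit.
have Uz : z ^+ n.-1 \in units_in (Aloc p).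
  by apply: units_in_loc; rewrite rpredX //; apply/units_inP.
have pi0 := ramif_unif_neq0 pp pn; set pi := ramif_unif p in pi0 *.
set e0 := (ramif_exp p * p.-1)%N in s *.
have Un : n%:R / pi ^+ (logn p n * e0) \in units_in (Aloc p).
  have [N coN nN] := pfactor_coprime pp n_gt0.
  have N0 : (0 < N)%N by move: n_gt0; rewrite nN muln_gt0 => /andP[].
  rewrite {1}nN natrM natrX -mulrA mulnC exprM -expr_div_n.
  by rewrite rpredM ?units_in_nat // rpredX // units_in_loc // ramif_unif_p.
have Uzp : (z ^+ (n %/ p) - 1) / pi ^+ ramif_exp p \in units_in (Aloc p).
  by rewrite -opprB mulNr rpredN units_in_loc // ramif_unif_prim.
apply: (mem_eq (rpred_div (rpredM Un Uz) (rpredM Uzp UR))).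
have zp0 := units_in_neq0 Uzp; have R0 := units_in_neq0 UR.
have z10 : z ^+ (n %/ p) - 1 != 0 by apply: contraNneq zp0 => ->; rewrite mul0r.
have -> : n%:R / pi ^+ (logn p n * e0) * z ^+ n.-1 =
   PhiF^`().[z] * ((z ^+ (n %/ p) - 1) * (map_poly intr R).[z]) / pi ^+ (logn p n * e0).
  by rewrite eu mulrAC.
have -> : (logn p n * e0 = s + ramif_exp p)%N.
  rewrite /s subnK // /e0 mulnCA leq_pmulr // muln_gt0 r0 /= -subn1 subn_gt0 //.
rewrite exprD; field.
by rewrite ?expf_neq0 // R0 z10.
Qed.

End ExplicitUniformizers.

(** * Modular ideals of the real subfield *)

Section RealSubfield.
Variables (F K : fieldExtType rat) (n : nat) (z : F).
Hypothesis prim_z : n.-primitive_root z.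
Hypothesis gen_z : rat_generated z.
Variables (iota : {rmorphism K -> F}) (conj : {rmorphism F -> F}).
Hypothesis conj_z : conj z = z^-1.
Hypothesis fixK : forall x, conj x = x <-> exists y, x = iota y.

Local Notation A := (cycint z).
Local Notation Aloc p := (cycloc p z).
Local Notation PhiF := (map_poly (intr : int -> F) 'Phi_n).
Local Notation diff := (PhiF^`().[z]).
Local Notation tau := (top_coord n z).
Local Notation OK := (@ring_of_integers K).

Let n_gt0 : (0 < n)%N := prim_order_gt0 prim_z.
Let Az : z \in A := cycint_gen z.

Lemma exists_uniformizer p : prime p -> exists pi e, uniformizer z p pi e.
Proof.
move=> pp; have [pn|pn] := boolP (p %| n)%N.
  by eexists _, _; exact: uniformizer_ram pn.
by eexists _, _; exact: uniformizer_unram pn.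
Qed.

(** The ring of integers of F is Z[z]: integral elements are in every
    localization. *)
Lemma integral_cycint x : integralOver (intr : int -> F) x <-> x \in A.
Proof.
split=> [intx | /cycintP[P ->]].
  apply: (cyc_locglob gen_z) => p pp; have [pi [e upi]] := exists_uniformizer pp.
  exact: (unif_integral gen_z upi).
apply: integral_horner.
  apply/integral_poly => i; rewrite coef_map; exact: integral_id.
exists ('X^n - 1); first by rewrite monicXnsubC.
by rewrite rmorphB rmorph1 /= map_polyXn rootE !hornerE (prim_expr_order prim_z) subrr.
Qed.

Lemma ring_of_integersE y : OK y <-> iota y \in A.
Proof.
rewrite -integral_cycint; split=> -[P monP rP]; exists P => //.
  have -> : map_poly (intr : int -> F) P = map_poly iota (map_poly intr P).
    by rewrite -map_poly_comp; apply: eq_map_poly => c /=; rewrite rmorph_int.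
  by rewrite fmorph_root.
rewrite -(fmorph_root iota) -map_poly_comp.
by rewrite (eq_map_poly (g := intr)) // => c /=; rewrite rmorph_int.
Qed.

Lemma conj_horner_rat (P : {poly rat}) x :
  conj (map_poly (in_alg F) P).[x] = (map_poly (in_alg F) P).[conj x].
Proof.
rewrite -horner_map -map_poly_comp; congr (_.[_]); apply: eq_map_poly => c.
by rewrite (fmorph_eq_rat (conj \o in_alg F)) (fmorph_eq_rat (in_alg F)).
Qed.

Lemma conj_horner_int (P : {poly int}) x :
  conj (map_poly intr P).[x] = (map_poly intr P).[conj x].
Proof.
rewrite -horner_map -map_poly_comp; congr (_.[_]); apply: eq_map_poly => c /=.
by rewrite rmorph_int.
Qed.

Lemma conjK x : conj (conj x) = x.
Proof.
have [P ->] := gen_z x; rewrite !conj_horner_rat conj_z.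
by rewrite fmorphV conj_z invrK.
Qed.

Lemma conj_cycint x : x \in A -> conj x \in A.
Proof.
by case/cycintP => P ->; rewrite conj_horner_int conj_z horner_int_cycint ?(cycint_inv prim_z).
Qed.

Lemma conj_iota y : conj (iota y) = iota y.
Proof. by apply/fixK; exists y. Qed.

Lemma trace_exists x : exists y, iota y = x + conj x.
Proof.
have /fixK[y ->] : conj (x + conj x) = x + conj x by rewrite rmorphD conjK addrC.
by exists y.
Qed.

Definition rel_trace x : K := projT1 (cid (trace_exists x)).

Lemma rel_traceE x : iota (rel_trace x) = x + conj x.
Proof. exact: projT2 (cid (trace_exists x)). Qed.

Lemma rel_traceZ c x : rel_trace (iota c * x) = c * rel_trace x.
Proof.
apply: (fmorph_inj iota).
by rewrite rmorphM !rel_traceE rmorphM conj_iota mulrDr.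
Qed.

Lemma rel_trace_int x : x \in A -> OK (rel_trace x).
Proof.
by move=> Ax; apply/ring_of_integersE; rewrite rel_traceE rpredD // conj_cycint.
Qed.

Hypothesis unit_z : z - z^-1 \in units_in A.

(** On K, multiplication by the trace x + conj x is y |-> Tr_(F/K)(x y), which the
    dual frame of F writes as a sum of rank-one maps. In the resulting sum the
    terms from z give Phi_n'(z), and those from its conjugate vanish. *)
Lemma field_trace_rel x : field_trace (rel_trace x) = tau (diff * x).
Proof.
pose D := (totient n).-1.+1.
have iota_lin a y y' : iota (a *: y + y') = a *: iota y + iota y'.
  by rewrite rmorphD; congr (_ + _); apply: (rat_linear (rmorphB iota)).
rewrite (@field_trace_dyad K D _ (fun i y => tau (x * iota y * z ^+ i))
   (fun i => rel_trace (euler_coef n z i))).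
- transitivity (\sum_(i < D) tau (x * (z ^+ i * euler_coef n z i)) +
                \sum_(i < D) tau (x * (z ^+ i * euler_coef n z^-1 i))).
    rewrite -big_split; apply: eq_bigr => i _ /=.
    rewrite rel_traceE -linearD /=; congr (tau _).
    rewrite /euler_coef; set Q := drop_poly _ _.
    have -> : Q = map_poly intr (drop_poly i.+1 'Phi_n).
      by apply/polyP => j; rewrite coef_map !coef_drop_poly coef_map.
    rewrite conj_horner_int conj_z; ring.
  rewrite -!linear_sum -!mulr_sumr /= euler_sum_diag // euler_sum_off //.
  + by rewrite mulr0 linear0 addr0 mulrC.
  + exact: Cyclotomic_root (prim_root_inv prim_z).
  + by have /units_in_neq0 := unit_z; rewrite subr_eq0 eq_sym.
- by move=> i a y y'; rewrite iota_lin mulrDr mulrDl -scalerAr -scalerAl linearP.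
- move=> y; apply: (fmorph_inj iota).
  have iotaZ a y' : iota (a *: y') = a *: iota y'.
    by apply: (rat_linear (rmorphB iota)).
  rewrite mulrC -rel_traceZ rel_traceE rmorph_sum /=.
  rewrite mulrC {1 2}(dual_frame prim_z gen_z (x * iota y)) rmorph_sum -big_split.
  apply: eq_bigr => i _ /=; rewrite iotaZ rel_traceE scalerDr; congr (_ + _).
  by apply: (rat_linear (rmorphB conj)).
Qed.

(** F/K is unramified: z - z^-1, whose square is the discriminant of the basis
    1, z, is a unit. So the relative trace maps A onto the integers of K. *)
Lemma trace_one : exists2 u, u \in A & u + conj u = 1.
Proof.
have v0 := units_in_neq0 unit_z.
exists (z / (z - z^-1)); first by rewrite rpredM // units_in_subV.
rewrite fmorph_div rmorphB fmorphV conj_z invrK -(opprB z z^-1) invrN mulrN.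
by rewrite -mulrBl divff.
Qed.

Lemma modularP (I : set K) (b : K) : b != 0 ->
  I = [set b * x | x in dual_lattice I 1] <->
  (forall x, I x <-> forall y, I y -> field_trace (b^-1 * x * y) \is a Num.int).
Proof.
move=> b0; split=> [eI x | memI].
  rewrite {1}eI; split=> [[y yI <-] w Iw | xI].
    by rewrite mulKf //; have := yI w Iw; rewrite /trace_form mul1r.
  exists (b^-1 * x); last by rewrite mulVKf.
  by move=> y Iy; rewrite /trace_form mul1r; apply: xI.
apply/seteqP; split=> x.
  move/memI => xI; exists (b^-1 * x); last by rewrite mulVKf.
  by move=> y Iy; rewrite /trace_form mul1r; apply: xI.
case=> y yI <-; apply/memI => w Iw.
by rewrite mulKf //; have := yI w Iw; rewrite /trace_form mul1r.
Qed.

(** The inclusion I^2 in b D^{-1}, one square at a time. *)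
Lemma modular_square (I : set K) (b : K) x : b != 0 -> fractional_ideal I ->
  I = [set b * x | x in dual_lattice I 1] -> I x ->
  (iota b)^-1 * iota x ^+ 2 * diff \in A.
Proof.
move=> b0 [[_ _ IZ] _ _] /(modularP _ b0) memI Ix.
apply: (cycint_dual prim_z gen_z) => a Aa.
have -> : (iota b)^-1 * iota x ^+ 2 * diff * a =
    diff * (iota (b^-1 * x * x) * a) by rewrite !rmorphM fmorphV; ring.
rewrite -field_trace_rel rel_traceZ.
have /memI/(_ _ Ix) := IZ _ _ (rel_trace_int Aa) Ix.
by move=> tr; apply: (mem_eq tr); congr (field_trace _); ring.
Qed.

(** I is in pi^(-j) A_p, since its squares are in b D^{-1}, of valuation
    k - s = -2 j - 1. On the other hand with w = pi^(-j-1), Tr(N w a) pairs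
    integrally with b^{-1} I for every a in A and a suitable N prime to p, so it
    is in I. As F/K is unramified, N w is recovered from Tr(N w) and Tr(N w z), so
    that pi^j w = 1 / pi would be in A_p. *)
Lemma modular_obstruction p pi e (I : set K) (b : K) s k j :
    uniformizer z p pi e -> b != 0 -> fractional_ideal I ->
    I = [set b * x | x in dual_lattice I 1] ->
    diff / pi ^+ s \in units_in (Aloc p) -> iota b / pi ^+ k \in units_in (Aloc p) ->
  s = (k + j.*2.+1)%N -> False.
Proof.
move=> upi b0 fracI modI Us Uk es.
have pp : prime p by case: upi.
have pi0 : pi != 0 by case: upi => _ [].
have Api : pi \in Aloc p by case: upi => _ [/cycint_loc].
have memI := (modularP I b0).1 modI.
have B0 : iota b != 0 by rewrite fmorph_eq0.
have D0 : diff != 0.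
  by apply: contraNneq (units_in_neq0 Us) => ->; rewrite mul0r.
have bound x : I x -> pi ^+ j * iota x \in Aloc p.
  move=> Ix; apply: (unif_root_closed gen_z upi).
  apply: (mem_eq (rpredM (cycint_loc p (modular_square b0 fracI modI Ix))
    (rpredM (units_in_sub Uk) (units_in_subV Us)))).
  rewrite es exprD (exprS pi j.*2) -muln2 exprM.
  by field; rewrite B0 D0 pi0 !expf_neq0.
have [[_ _ IZ] _ [d [Od d0] dI]] := fracI.
have iota_d0 : iota d != 0 by rewrite fmorph_eq0.
pose w := (pi ^+ j.+1)^-1.
have [M M0 AM] := cyc_denom gen_z ((iota b)^-1 * diff * w / iota d).
have [N coN MN] := pfactor_coprime pp M0.
set c := logn p M in MN.
(* N is the prime-to-p part of a denominator M that is common to all y in I: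
   it clears the primes other than p, while at p nothing has to be cleared. *)
have IN a : a \in A -> I (rel_trace (N%:R * w * a)).
  move=> Aa; apply/memI => y Iy.
  have -> : b^-1 * rel_trace (N%:R * w * a) * y =
      rel_trace (iota (b^-1 * y) * (N%:R * w * a)) by rewrite rel_traceZ; ring.
  rewrite field_trace_rel; apply: (top_coord_int prim_z).
  have -> : diff * (iota (b^-1 * y) * (N%:R * w * a)) =
     N%:R * ((iota b)^-1 * diff * w * iota y * a).
    by rewrite rmorphM fmorphV; ring.
  apply: (@cycloc_denom _ _ p c) => //.
    apply: (mem_eq (rpredM (rpredM (units_in_sub Us) (units_in_subV Uk))
      (rpredM (bound _ Iy) (cycint_loc p Aa)))).
    rewrite /w es exprD (exprS pi j.*2) (exprS pi j) -muln2 exprM.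
    by field; rewrite B0 pi0 !expf_neq0.
  have -> : (p ^ c * N)%N = M by rewrite mulnC -MN.
  have Ady : iota (d * y) \in A by apply/ring_of_integersE/dI.
  apply: (mem_eq (rpredM (rpredM AM Ady) Aa)).
  by rewrite rmorphM; field; rewrite B0 iota_d0.
have wN : pi ^+ j * (N%:R * w) \in Aloc p.
  have Aw1 := bound _ (IN _ (rpred1 _)); have Awz := bound _ (IN _ Az).
  have Aunit := cycint_loc p (units_in_subV unit_z).
  apply: (mem_eq (rpredM (rpredB Awz (rpredM (cycint_loc p (cycint_inv prim_z)) Aw1)) Aunit)).
  rewrite !rel_traceE !rmorphM rmorph1 conj_z.
  have := units_in_neq0 unit_z.
  set v := z^-1 => v0; set cw := conj w; set cN := conj N%:R; set t := pi ^+ j; field.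
  exact: v0.
have /negP[] := unif_inv_notin prim_z upi.
apply: (mem_eq (rpredM wN (cycloc_natV z coN))).
have N0 : N%:R != 0 :> F.
  by apply: natr_neq0; case: N MN {coN IN wN} => // M0'; rewrite M0' in M0.
by rewrite /w (exprS pi j); field; rewrite N0 pi0 expf_neq0.
Qed.

(** g^{-1} A is its own dual up to b by the hypothesis on the different; the
    relative trace maps it onto its intersection with K because it is stable
    under conjugation and F/K is unramified. *)
Lemma modular_exists (g : F) (b : K) :
    b != 0 -> g != 0 -> g \in A -> conj g / g \in units_in A ->
    diff / (g ^+ 2 * iota b) \in units_in A ->
  exists I : set K, fractional_ideal I /\ I = [set b * x | x in dual_lattice I 1].
Proof.
move=> b0 g0 Ag Ucg Ud; exists [set x | g * iota x \in A].
have B0 : iota b != 0 by rewrite fmorph_eq0.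
have cg0 : conj g != 0 by rewrite fmorph_eq0.
have D0 : diff != 0.
  by apply: contraNneq (units_in_neq0 Ud) => ->; rewrite mul0r.
split.
  split.
  - split=> [|x y|c x] /=.
    + by rewrite rmorph0 mulr0 rpred0.
    + by move=> Ax Ay; rewrite rmorphD mulrDr rpredD.
    + by move/ring_of_integersE=> Ac Ax; rewrite rmorphM mulrCA rpredM.
  - by exists 1; rewrite ?oner_neq0 //= rmorph1 mulr1.
  - have /fixK[d Ed] : conj (g * conj g) = g * conj g by rewrite rmorphM conjK mulrC.
    exists d => [|x /= Ax].
      split; first by apply/ring_of_integersE; rewrite -Ed rpredM // conj_cycint.
      by rewrite -(fmorph_eq0 iota) -Ed mulf_neq0.
    by apply/ring_of_integersE; rewrite rmorphM -Ed mulrAC rpredM // conj_cycint.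
apply/modularP => // x /=; split=> [Ax y /= Ay | xI].
- have [u Au u1] := trace_one.
  have -> : b^-1 * x * y = rel_trace (iota (b^-1 * x * y) * u).
    apply: (fmorph_inj iota).
    by rewrite rel_traceE rmorphM conj_iota -mulrDr u1 mulr1.
  rewrite field_trace_rel; apply: (top_coord_int prim_z).
  apply: (mem_eq (rpredM (rpredM (units_in_sub Ud) (rpredM Ax Ay)) Au)).
  by rewrite !rmorphM fmorphV; field; rewrite B0 g0.
- suff Adx : diff / (g * iota b) * iota x \in A.
    apply: (mem_eq (rpredM (units_in_subV Ud) Adx)).
    by field; rewrite B0 g0 D0.
  apply: (cycint_dual prim_z gen_z) => a Aa.
  have -> : diff / (g * iota b) * iota x * a = diff * (iota (b^-1 * x) * (g^-1 * a)).
    by rewrite rmorphM fmorphV; field; rewrite B0 g0.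
  rewrite -field_trace_rel rel_traceZ; apply: xI => /=.
  rewrite rel_traceE rmorphM fmorphV.
  apply: (mem_eq (rpredD Aa (rpredM (units_in_subV Ucg) (conj_cycint Aa)))).
  by field; rewrite cg0 g0.
Qed.

End RealSubfield.

(** * Ramified primes of the real subfield *)

Section PrimeIdeals.
Variable K : fieldExtType rat.
Local Notation OK := (@ring_of_integers K).

(** An ideal maximal among those containing Q and not 1. The empty set is admitted
    in the order only so that the empty chain has an upper bound. *)
Lemma exists_prime_above (Q : set K) :
  OK_submodule Q -> Q `<=` OK -> ~ Q 1 -> exists2 P, prime_ideal P & Q `<=` P.
Proof.
move=> [Q0 QD QZ] QO Q1.
pose good (X : set K) := [/\ OK_submodule X, Q `<=` X, X `<=` OK & ~ X 1].
(* maximality is among the good sets and the empty one *)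
have [P [goodP maxP]] : exists P, (P = set0 \/ good P) /\
    forall B, P `<` B -> ~ (B = set0 \/ good B).
  apply: Zorn_bigcup => G Ggood Gtot.
  have [[X GX goodX]|nogood] := pselect (exists2 X, G X & good X); last first.
    left; apply/seteqP; split=> // x [X GX Xx].
    have [X0|gX] := Ggood _ GX; first by rewrite X0 in Xx.
    by case: nogood; exists X.
  have comb x y : (\bigcup_(X in G) X) x -> (\bigcup_(X in G) X) y ->
      exists X, [/\ G X, good X, X x & X y].
    move=> [Y GY Yx] [Z GZ Zy].
    have gY : good Y by case: (Ggood _ GY) => // Y0; rewrite Y0 in Yx.
    have gZ : good Z by case: (Ggood _ GZ) => // Z0; rewrite Z0 in Zy.
    have [YZ|ZY] := Gtot _ _ GY GZ; first by exists Z; split=> //; apply: YZ.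
    by exists Y; split=> //; apply: ZY.
  right; split; first split.
  - by exists X => //; case: goodX => -[].
  - move=> x y Ux Uy; have [Y [GY [[_ YD _] _ _ _] Yx Yy]] := comb _ _ Ux Uy.
    by exists Y => //; apply: YD.
  - move=> c x Oc Ux; have [Y [GY [[_ _ YZ] _ _ _] Yx _]] := comb _ _ Ux Ux.
    by exists Y => //; apply: YZ.
  - by move=> x Qx; exists X => //; case: goodX => _ QX _ _; apply: QX.
  - by move=> x Ux; have [Y [GY [_ _ YO _] Yx _]] := comb _ _ Ux Ux; apply: YO.
  - by move=> U1; have [Y [GY [_ _ _ Y1] Y1' _]] := comb _ _ U1 U1.
have {goodP} [P0|[[P0 PD PZ] QP PO P1]] := goodP.
  case: (maxP Q); last by right; split.
  by rewrite P0; split => // /(_ _ Q0).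
exists P => //; split=> // x y Ox Oy Pxy.
have [|nPx] := pselect (P x); first by left.
right; apply: contrapT => nPy.
case: (maxP [set w | exists m c, [/\ P m, OK c & w = m + x * c]]).
  split.
    by move=> m Pm; exists m, 0; split; rewrite ?mulr0 ?addr0 //; exact: integral0.
  move=> /(_ x) Px; apply/nPx/Px; exists 0, 1; split; rewrite ?mulr1 ?add0r //.
  exact: integral1.
right; split; first split.
- by exists 0, 0; split; rewrite ?mulr0 ?addr0 //; exact: integral0.
- move=> _ _ [m [c [Pm Oc ->]]] [m' [c' [Pm' Oc' ->]]].
  exists (m + m'), (c + c'); split; [exact: PD | exact: integral_add | by ring].
- move=> a _ Oa [m [c [Pm Oc ->]]].
  exists (a * m), (a * c); split; [exact: PZ | exact: integral_mul | by ring].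
- move=> m Qm; exists m, 0; split; rewrite ?mulr0 ?addr0 //; [exact: QP | exact: integral0].
- move=> _ [m [c [Pm Oc ->]]]; apply: integral_add; first exact: PO.
  exact: integral_mul.
- move=> [m [c [Pm Oc e1]]]; apply: nPy.
  have -> : y = y * m + c * (x * y) by rewrite -{1}[y]mulr1 e1; ring.
  by apply: PD; apply: PZ.
Qed.

End PrimeIdeals.

Section Ramification.
Variables (F K : fieldExtType rat) (n : nat) (z : F).
Hypothesis prim_z : n.-primitive_root z.
Hypothesis gen_z : rat_generated z.
Variables (iota : {rmorphism K -> F}) (conj : {rmorphism F -> F}).
Hypothesis conj_z : conj z = z^-1.
Hypothesis fixK : forall x, conj x = x <-> exists y, x = iota y.

Local Notation A := (cycint z).
Local Notation Aloc p := (cycloc p z).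
Local Notation OK := (@ring_of_integers K).
Local Notation OKE := (ring_of_integersE prim_z gen_z iota).

(** Let p be the sum of the u.1 u.2 with all u.1 and u.2 in P, and let ee be the
    product of the 1 - x^(q-1) over these elements x. As x^q = x mod p, ee kills
    them mod p, so p ee^2 is in p^2 O_K and ee^2 in p O_K, inside P; but ee = 1
    mod P. *)
Lemma unramified p : prime p -> ~~ (p %| n)%N -> ~ ramified K p.
Proof.
move=> pp pn [_ [P [[P0 PD PZ] PO P1 Pprime] [s sP ps]]].
have upi := uniformizer_unram prim_z pp pn.
have p0 : p%:R != 0 :> K := natr_neq0 K (prime_gt0 pp).
have [_ _ _ _ [q q1 frobF]] := upi.
have frob x : OK x -> OK ((x ^+ q - x) / p%:R).
  move/OKE=> Ax; apply/OKE.
  by rewrite fmorph_div rmorphB rmorphXn rmorph_nat; apply: frobF.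
have q2 : q.-1 = q.-2.+1 by rewrite prednK // -subn1 subn_gt0.
have q1' : q = q.-1.+1 by rewrite prednK // ltnW.
have OX x k : OK x -> OK (x ^+ k).
  by move=> Ox; elim: k => [|k IH]; [exact: integral1 | rewrite exprS; exact: integral_mul].
pose t := unzip1 s ++ unzip2 s.
have tP x : x \in t -> P x.
  by rewrite mem_cat => /orP[] /mapP[u us ->]; have [] := sP u us.
pose ee (t : seq K) := \prod_(x <- t) (1 - x ^+ q.-1).
have eO r : (forall x, x \in r -> P x) -> OK (ee r).
  elim: r => [|x r IH] rP; first by rewrite /ee big_nil; exact: integral1.
  rewrite /ee big_cons; apply: integral_mul.
    by apply: integral_sub; [exact: integral1 | apply/OX/PO/rP/mem_head].
  by apply: IH => y yr; apply: rP; rewrite inE yr orbT.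
have eP r : (forall x, x \in r -> P x) -> P (1 - ee r).
  elim: r => [|x r IH] rP; first by rewrite /ee big_nil subrr.
  have rP' y : y \in r -> P y by move=> yr; apply: rP; rewrite inE yr orbT.
  have Px := rP x (mem_head _ _).
  have -> : 1 - ee (x :: r) = (1 - ee r) + (x ^+ q.-2 * ee r) * x.
    rewrite /ee big_cons -/(ee r); by rewrite q2 exprS; ring.
  apply: PD; first exact: IH.
  by apply: PZ => //; apply: integral_mul; [apply/OX/PO | exact: eO].
have et x : x \in t -> OK (ee t * x / p%:R).
  move=> xt; rewrite /ee (big_rem x) //= -/(ee _).
  have -> : (1 - x ^+ q.-1) * ee (rem x t) * x / p%:R =
      (- ee (rem x t)) * ((x ^+ q - x) / p%:R).
    by rewrite {2}q1' exprS; ring.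
  apply: integral_mul; last by apply/frob/PO/tP.
  by apply/integral_opp/eO => y /mem_rem/tP.
have e2 : P (ee t ^+ 2).
  have -> : ee t ^+ 2 =
    (\sum_(u <- s) (ee t * u.1 / p%:R) * (ee t * u.2 / p%:R)) * p%:R.
    have -> : \sum_(u <- s) ee t * u.1 / p%:R * (ee t * u.2 / p%:R) =
        ee t ^+ 2 / p%:R ^+ 2 * \sum_(u <- s) u.1 * u.2.
      by rewrite mulr_sumr; apply: eq_bigr => u _; field.
    by rewrite -ps; field.
  apply: (PZ); last first.
    rewrite ps big_seq; apply: (big_ind P) => // u us.
    by have [Pu1 Pu2] := sP u us; apply: PZ => //; apply: PO.
  rewrite big_seq; apply: (big_ind OK) => [|x y Ox Oy|u us].
  - exact: integral0.
  - exact: integral_add.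
  apply: integral_mul; apply: et.
    by rewrite mem_cat map_f.
  by rewrite mem_cat orbC map_f.
have {}e2 : P (ee t).
  by have [] := Pprime _ _ (eO _ tP) (eO _ tP) (e2 : P (ee t * ee t)).
apply: P1; have -> : 1 = (1 - ee t) + ee t by rewrite subrK.
by apply: PD => //; apply: eP.
Qed.

Lemma conj_ramif_unif p : prime p -> (p %| n)%N ->
  conj (ramif_unif n z p) / ramif_unif n z p \in units_in A.
Proof.
move=> pp pn; have pi0 := ramif_unif_neq0 prim_z pp pn.
have z0 := prim_root_neq0 prim_z.
have -> : conj (ramif_unif n z p) / ramif_unif n z p = - z^-1 ^+ (n`_p^')%N.
  apply: (mulIf pi0); rewrite divfK // /ramif_unif rmorphB rmorph1 rmorphXn /= conj_z.
  rewrite exprVn; set w := z ^+ _; have w0 : w != 0 by rewrite expf_neq0.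
  by field.
rewrite rpredN rpredX //; apply/units_inP.
by rewrite invr_eq0 invrK z0 (cycint_inv prim_z) cycint_gen.
Qed.

Hypothesis unit_z : z - z^-1 \in units_in A.

(** Let Q be the intersection of K with pi A. The relative trace maps pi A into Q,
    and pi is a combination over A of the elements Tr(pi z) and Tr(pi) of Q. As
    pi^2 divides p, the trace of a multiple u p with u of trace 1 writes p as a
    sum of two products of elements of Q. *)
Lemma ramified_dvd p : prime p -> odd p -> (p %| n)%N -> ramified K p.
Proof.
move=> pp op pn; split=> //.
have upi := uniformizer_ram prim_z pp pn.
set pi := ramif_unif n z p in upi.
have Api : pi \in A by case: upi => _ [].
have pi0 : pi != 0 by case: upi => _ [].
have Ucpi := conj_ramif_unif pp pn; rewrite -/pi in Ucpi.
pose tr := rel_trace gen_z conj_z fixK.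
pose Q : set K := [set x | iota x / pi \in A].
have QO : Q `<=` OK.
  by move=> x /= Qx; apply/OKE; apply: (mem_eq (rpredM Qx Api)); rewrite divfK.
have Qmod : OK_submodule Q.
  rewrite /Q; split=> [|x y|c x] /=.
  - by rewrite rmorph0 mul0r rpred0.
  - by move=> Ax Ay; rewrite rmorphD mulrDl rpredD.
  - by move=> /OKE Ac Ax; rewrite rmorphM -mulrA rpredM.
have Q1 : ~ Q 1.
  rewrite /Q /= rmorph1 mul1r => /(cycint_loc p); apply/negP.
  exact: (unif_inv_notin prim_z upi).
have [P primeP QP] := exists_prime_above Qmod QO Q1.
exists P => //.
have trQ a : a \in A -> Q (tr (pi * a)).
  move=> Aa; rewrite /Q /= rel_traceE rmorphM mulrDl.
  rewrite [pi * a]mulrC mulfK // mulrAC rpredD // rpredM ?(units_in_sub Ucpi) //.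
  exact: (conj_cycint prim_z conj_z).
have [u Au u1] := trace_one conj_z unit_z.
have v0 := units_in_neq0 unit_z.
have Av : (z - z^-1)^-1 \in A := units_in_subV unit_z.
have Ap2 : p%:R / pi ^+ 2 \in A.
  have Uppi := units_in_sub (ramif_unif_p prim_z pp pn).
  set e := (_ * _)%N in Uppi; have e2 : (1 < e)%N.
    rewrite /e -[2%N]mul1n leq_mul ?expn_gt0 ?prime_gt0 //.
    by rewrite -ltnS prednK ?prime_gt0 // odd_prime_gt2.
  apply: (mem_eq (rpredM Uppi (rpredX (e - 2) Api))).
  clearbody e; rewrite -/pi -{1}(subnK e2) exprD; set t := pi ^+ (_ - _)%N.
  have t0 : t != 0 by rewrite expf_neq0.
  by field; rewrite pi0 t0.
have [a Aa pa] : exists2 a, a \in A & p%:R = a * pi ^+ 2.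
  by exists (p%:R / pi ^+ 2); rewrite ?divfK // expf_neq0.
exists [:: (tr (pi * z), tr (pi * (a * u / (z - z^-1))));
           (tr (pi * 1), tr (pi * (- z^-1 * a * u / (z - z^-1))))].
  move=> w; rewrite !inE => /orP[] /eqP -> /=; split; apply/QP/trQ;
    rewrite ?rpred1 ?cycint_gen //.
    by rewrite rpredM // rpredM.
  by rewrite !rpredM // rpredN (cycint_inv prim_z).
rewrite big_cons big_seq1 /=; apply: (fmorph_inj iota).
rewrite rmorphD !rmorphM rmorph_nat.
have C1 := rel_traceE gen_z conj_z fixK (pi * z).
have C2 := rel_traceE gen_z conj_z fixK (pi * 1).
have key : p%:R * u = iota (tr (pi * z)) * (pi * (a * u / (z - z^-1))) +
    iota (tr (pi * 1)) * (pi * (- z^-1 * a * u / (z - z^-1))).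
  rewrite C1 C2 !rmorphM rmorph1 conj_z.
  rewrite pa.
  set v := z^-1 in v0 *; set b := conj pi.
  by field.
have -> : p%:R = p%:R * u + conj (p%:R * u) :> F.
  by rewrite rmorphM rmorph_nat -mulrDr u1 mulr1.
rewrite key rmorphD !(rmorphM conj (iota _)) !(conj_iota fixK).
rewrite !(rel_traceE gen_z conj_z fixK (pi * (_ / _))).
by ring.
Qed.

End Ramification.

(** * Valuations of square roots of the level *)

Lemma squarefree_logn l p :
  (0 < l)%N -> square_free l -> prime p -> (p %| l)%N -> logn p l = 1%N.
Proof.
move=> l0 sql pp pl; have : (0 < logn p l)%N by rewrite logn_gt0 mem_primes pp l0.
apply: contraPeq => l1; rewrite lt0n => l0'.
have l2 : (1 < logn p l)%N by case: (logn p l) l1 l0' => [|[]].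
have := sql p; rewrite pfactor_dvdn // => /(_ l2) p1.
by rewrite p1 in pp.
Qed.

Section SquareRoots.
Variables (F : fieldExtType rat) (n : nat) (z : F).
Hypothesis prim_z : n.-primitive_root z.
Hypothesis gen_z : rat_generated z.

Local Notation A := (cycint z).
Local Notation Aloc p := (cycloc p z).

Section Local.
Variables (p e : nat) (pi : F).
Hypothesis upi : uniformizer z p pi e.
Variables (l : nat) (b : F).
Hypotheses (l0 : (0 < l)%N) (sql : square_free l) (bl : b ^+ 2 = l%:R).

Let pp : prime p. Proof. by case: upi. Qed.
Let pi0 : pi != 0. Proof. by case: upi => _ []. Qed.

Lemma sqrt_unit : ~~ (p %| l)%N -> b \in units_in (Aloc p).
Proof.
move=> pl; apply: (unif_sqrt_unit gen_z upi).
by rewrite bl units_in_nat // prime_coprime.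
Qed.

Lemma squarefree_unif : (p %| l)%N -> l%:R / pi ^+ e \in units_in (Aloc p).
Proof.
move=> pl; have [N coN lN] := pfactor_coprime pp l0.
rewrite lN squarefree_logn // expn1 natrM -mulrA.
have N0 : (0 < N)%N by move: l0; rewrite lN muln_gt0 => /andP[].
by rewrite rpredM ?units_in_nat //; case: upi.
Qed.

Lemma sqrt_unif h : (p %| l)%N -> e = h.*2 -> b / pi ^+ h \in units_in (Aloc p).
Proof.
move=> pl eh; apply: (unif_sqrt_unit gen_z upi).
by rewrite expr_div_n -exprM muln2 -eh bl squarefree_unif.
Qed.

(** Otherwise l, exactly divisible by p, is associate to pi, and pi (1/b)^2 is a
    unit at p; so 1/b is integral there, and then so is 1/pi. *)
Lemma sqrt_no_odd : e = 1%N -> ~~ (p %| l)%N.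
Proof.
move=> e1; apply/negP => pl; have Ul := squarefree_unif pl.
rewrite e1 expr1 in Ul; have /negP[] := unif_inv_notin prim_z upi.
have l0' : l%:R != 0 :> F by rewrite natr_neq0.
have b0 : b != 0 by rewrite -sqrf_eq0 bl.
have Ab : b^-1 \in Aloc p.
  apply: (unif_root_closed gen_z upi); rewrite exprVn bl.
  by have := units_in_subV Ul; rewrite invf_div.
apply: (mem_eq (rpredM (units_in_sub Ul) (rpredX 2 Ab))).
by rewrite exprVn bl; field; rewrite l0' pi0.
Qed.

End Local.

(** Otherwise y = (1 + x) / 2 has 2 y^2 = x, so it is integral at 2, although
    y^4 = - 1/4. *)
Lemma no_sqrt_m1 (x : F) : odd n -> x ^+ 2 != -1.
Proof.
move=> odd_n; apply/eqP => x2.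
have u2 : uniformizer z 2 2%:R 1.
  by apply: (uniformizer_unram prim_z) => //; rewrite dvdn2 odd_n.
have /negP[] := unif_inv_notin prim_z u2.
have t0 : 2%:R != 0 :> F by rewrite natr_neq0.
have Ax : x \in Aloc 2.
  by apply: (unif_root_closed gen_z u2); rewrite x2 rpredM // ?rpredN ?rpred_nat ?rpred1.
have Ay : (1 + x) / 2%:R \in Aloc 2.
  apply: (unif_root_closed gen_z u2); apply: (mem_eq Ax).
  rewrite expr_div_n sqrrD x2 expr1n; field.
  exact: natr_neq0.
have A2 : 2%:R \in Aloc 2 by rewrite rpred_nat.
have A4 : - ((1 + x) / 2%:R) ^+ 4 \in Aloc 2 by rewrite rpredN rpredX.
apply: (mem_eq (rpredM A2 A4)).
have y2 : ((1 + x) / 2%:R) ^+ 2 = x / 2%:R.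
  rewrite expr_div_n sqrrD x2 expr1n; field. by rewrite !natr_neq0.
rewrite -[4%N]/(2 * 2)%N exprM y2 expr_div_n x2; field.
by rewrite ?natr_neq0.
Qed.

(** Some power of z^2 has order p. For p = 2 this uses that 4 divides n. *)
Lemma one_sub_sq_dvd p : prime p -> (p %| n)%N -> (n %% 4 <> 2)%N ->
  p%:R / (1 - z ^+ 2) \in A.
Proof.
move=> pp pn n4.
have Az := cycint_gen z.
have n0 := prim_order_gt0 prim_z.
have [k pk] : exists k, p.-primitive_root ((z ^+ 2) ^+ k).
  have [op|ep] := boolP (odd p).
    exists (n %/ p)%N; rewrite -exprM mulnC exprM prim_root_exp_coprime ?coprime2n //.
    exact: dvdn_prim_root.
  have p2 : p = 2%N by apply/eqP; rewrite eq_sym; case/even_prime: pp ep => [->|->].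
  exists (n %/ 4)%N; rewrite -exprM.
  have -> : (2 * (n %/ 4) = n %/ p)%N.
    by move: pn n4; rewrite p2; lia.
  exact: dvdn_prim_root.
have p1 := prime_gt1 pp.
have w1 := one_sub_prim_neq0 p1 pk.
have z1 : 1 - z ^+ 2 != 0.
  apply: contraNneq w1 => /eqP; rewrite subr_eq0 => /eqP <-.
  by rewrite expr1n subrr.
have Aw : (1 - (z ^+ 2) ^+ k) / (1 - z ^+ 2) \in A.
  rewrite -{1}[1](expr1n _ k) subrXX mulrAC divff // mul1r rpred_sum // => i _.
  by rewrite rpredM ?rpredX ?rpred1.
have Apw : p%:R / (1 - (z ^+ 2) ^+ k) \in A.
  rewrite -(prod_one_sub_prim pk); case: p p1 {pp pn pk} => [|[|q]] // _.
  rewrite big_ord_recl expr1 mulrC mulKf // rpred_prod // => i _.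
  by rewrite rpredB ?rpred1 // !rpredX.
by apply: (mem_eq (rpredM Aw Apw)); field; rewrite z1 w1.
Qed.

(** n has two distinct prime factors, and 1 - z^2 divides both of them. *)
Lemma unit_sub_inv : (1 < n)%N -> ~ prime_power n -> (n %% 4 <> 2)%N ->
  z - z^-1 \in units_in A.
Proof.
move=> n1 npp n4; have n0 : (0 < n)%N by rewrite ltnW.
have z0 := prim_root_neq0 prim_z.
have pp := pdiv_prime n1; set p := pdiv n in pp.
have pn : (p %| n)%N := pdiv_dvd n.
have [N coN nN] := pfactor_coprime pp n0.
have N1 : (1 < N)%N.
  rewrite ltn_neqAle eq_sym; apply/andP; split.
    apply/eqP => N1; apply: npp; exists p, (logn p n); split=> //.
      by rewrite logn_gt0 mem_primes pp n0.
    by rewrite {1}nN N1 mul1n.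
  by move: n0; rewrite nN muln_gt0 => /andP[].
have qq := pdiv_prime N1; set q := pdiv N in qq.
have qN : (q %| N)%N := pdiv_dvd N.
have qn : (q %| n)%N by rewrite nN dvdn_mulr.
have pq : coprime p q by apply: coprime_dvdr coN.
have Ap := one_sub_sq_dvd pp pn n4; have Aq := one_sub_sq_dvd qq qn n4.
have z1 : 1 - z ^+ 2 != 0.
  rewrite subr_eq0 eq_sym -(prim_order_dvd prim_z).
  apply/negP => /(@dvdn_leq n 2 isT) n2; apply: n4.
  by have -> : n = 2%N by apply/eqP; rewrite eqn_leq n2 n1.
have A1 : (1 - z ^+ 2)^-1 \in A.
  have [u v uv _] := egcdnP q (prime_gt0 pp).
  move: uv; rewrite (eqP pq) => uv.
  have : (u * p)%:R / (1 - z ^+ 2) - (v * q)%:R / (1 - z ^+ 2) \in A.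
    by rewrite !natrM -!mulrA rpredB // rpredM ?rpred_nat.
  by rewrite uv -mulrBl natrD addrC addKr mul1r.
have Az := cycint_gen z; have Az' := cycint_inv prim_z.
have -> : z - z^-1 = - z^-1 * (1 - z ^+ 2) by field.
rewrite rpredM ?rpredN //; apply/units_inP; rewrite ?invr_eq0 ?invrK //.
by rewrite z1 A1 rpredB ?rpred1 ?rpredX.
Qed.

End SquareRoots.

(** * Arithmetic characterization of the levels *)

Lemma odd_pred_half p : odd p -> p.-1 = (p.-1./2).*2.
Proof. by case: p => //= p op; rewrite even_halfK. Qed.

Section Levels.
Variables (F K : fieldExtType rat) (n : nat) (z : F).
Hypothesis prim_z : n.-primitive_root z.
Hypothesis gen_z : rat_generated z.
Variables (iota : {rmorphism K -> F}) (conj : {rmorphism F -> F}).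
Hypothesis conj_z : conj z = z^-1.
Hypothesis fixK : forall x, conj x = x <-> exists y, x = iota y.

Local Notation A := (cycint z).
Local Notation Aloc p := (cycloc p z).
Local Notation OK := (@ring_of_integers K).
Local Notation diff := ((map_poly (intr : int -> F) 'Phi_n)^`().[z]).
Local Notation unif p := (ramif_unif n z p).
Local Notation dexp p := (logn p n * (ramif_exp n p * p.-1) - ramif_exp n p)%N.

Let n_gt0 : (0 < n)%N := prim_order_gt0 prim_z.

Lemma ModT_sqrt l : ModT K l ->
  [/\ (0 < l)%N, square_free l & exists (b : K) (I : set K),
      [/\ b != 0, fractional_ideal I, I = [set b * x | x in dual_lattice I 1]
        & b ^+ 2 = l%:R]].
Proof.
case=> l0 sql [I [[fracI _] _ [b [b0 modI lb]]]].
by split=> //; exists b, I.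
Qed.

Lemma ModT_intro l (b : K) (I : set K) : (0 < l)%N -> square_free l -> b != 0 ->
  fractional_ideal I -> I = [set b * x | x in dual_lattice I 1] ->
  b ^+ 2 = l%:R -> ModT K l.
Proof.
move=> l0 sql b0 fracI modI lb; split=> //; exists I; split=> //; last by exists b.
by split=> //; split=> [|sigma]; rewrite ?oner_neq0 // rmorph1 ltr01.
Qed.

Let iota_sq (b : K) l : b ^+ 2 = l%:R -> iota b ^+ 2 = l%:R.
Proof. by move=> lb; rewrite -rmorphXn lb rmorph_nat. Qed.

Lemma level_dvd l p : ModT K l -> prime p -> (p %| l)%N -> (p %| n)%N.
Proof.
case/ModT_sqrt=> l0 sql [b [I [b0 _ _ lb]]] pp; apply: contraTT => pn.
by apply: (sqrt_no_odd prim_z gen_z (uniformizer_unram prim_z pp pn) l0 sql (iota_sq lb)).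
Qed.

Hypothesis unit_z : z - z^-1 \in units_in A.

(** The different and b must have the same parity at p. *)
Lemma level_obstruction p (I : set K) (b : K) k : prime p -> (p %| n)%N -> b != 0 ->
    fractional_ideal I -> I = [set b * x | x in dual_lattice I 1] ->
    iota b / unif p ^+ k \in units_in (Aloc p) ->
  ~~ odd (dexp p - k)%N.
Proof.
move=> pp pn b0 fracI modI Uk; apply/negP => odd_sk.
apply: (modular_obstruction prim_z gen_z conj_z fixK unit_z (uniformizer_ram prim_z pp pn)
  b0 fracI modI (deriv_Phi_ram prim_z pp pn) Uk (j := (dexp p - k)./2)).
by have := odd_double_half (dexp p - k); have := odd_gt0 odd_sk; rewrite odd_sk; lia.
Qed.

Lemma ramif_exp_odd p : odd p -> odd (ramif_exp n p).
Proof. by move=> op; rewrite oddX op orbT. Qed.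

(** [dexp p] is the valuation of the different at p and h that of a square root
    of p. *)
Lemma dexp_sub_odd p (h := (ramif_exp n p * p.-1./2)%N) : prime p -> odd p -> (p %| n)%N ->
  [/\ odd (dexp p), (h <= dexp p)%N & odd (dexp p - h) = ~~ odd p.-1./2].
Proof.
move=> pp op pn; rewrite /h; have oE := ramif_exp_odd op; set E := ramif_exp n p in oE *.
have r0 : (0 < logn p n)%N by rewrite logn_gt0 mem_primes pp n_gt0.
have p3 : (2 < p)%N by apply: odd_prime_gt2.
have pt := odd_pred_half op.
have t0 : (0 < p.-1./2)%N by move: pt; lia.
set t := p.-1./2 in pt t0 *; rewrite pt -muln2 !mulnA muln2.
have E0 : (0 < E)%N by apply: odd_gt0.
have bnd : (E * t + E <= (logn p n * E * t).*2)%N by nia.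
have bE : (E <= (logn p n * E * t).*2)%N by apply: leq_trans bnd; apply: leq_addl.
rewrite leq_subRL // addnC bnd oddB // odd_double oE; split=> //.
by rewrite oddB ?leq_subRL 1?addnC // oddB // odd_double oE oddM oE.
Qed.

Lemma level_odd l p : ModT K l -> prime p -> odd p -> (p %| n)%N ->
  (p %| l)%N /\ (p %% 4 = 3)%N.
Proof.
case/ModT_sqrt=> l0 sql [b [I [b0 fracI modI lb]]] pp op pn.
have upi := uniformizer_ram prim_z pp pn.
have [os hs osh] := dexp_sub_odd pp op pn.
have pl : (p %| l)%N.
  apply: contraLR os => pl; rewrite -[dexp p]subn0.
  apply: (level_obstruction pp pn b0 fracI modI).
  by rewrite expr0 divr1 (sqrt_unit gen_z upi l0 (iota_sq lb)).
split=> //.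
have eh : (ramif_exp n p * p.-1 = (ramif_exp n p * p.-1./2).*2)%N.
  by rewrite {1}(odd_pred_half op) doubleMr.
have := level_obstruction pp pn b0 fracI modI
  (sqrt_unif gen_z upi l0 sql (iota_sq lb) pl eh).
rewrite osh negbK; move: op (prime_gt1 pp); lia.
Qed.

Lemma level_two l : ModT K l -> logn 2 n = 2%N -> ~~ (2 %| l)%N.
Proof.
case/ModT_sqrt=> l0 sql [b [I [b0 fracI modI lb]]] r2.
have n2 : (2 %| n)%N.
  by have : (0 < logn 2 n)%N by [rewrite r2]; rewrite logn_gt0 mem_primes => /and3P[].
have upi := uniformizer_ram prim_z (isT : prime 2) n2.
apply/negP => l2.
have eh : (ramif_exp n 2 * 2.-1 = 1.*2)%N by rewrite /ramif_exp r2.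
have := level_obstruction (isT : prime 2) n2 b0 fracI modI
  (sqrt_unif gen_z upi l0 sql (iota_sq lb) l2 eh).
by rewrite /ramif_exp r2.
Qed.

Lemma ramif_unif_unit p q : prime p -> prime q -> (p %| n)%N -> p != q ->
  unif p \in units_in (Aloc q).
Proof.
move=> pp qq pn pq.
have := units_in_loc q (ramif_unif_p prim_z pp pn).
have Up : p%:R \in units_in (Aloc q).
  by rewrite units_in_nat ?prime_gt0 // prime_coprime // dvdn_prime2 // eq_sym.
have A0 : unif p \in Aloc q by apply: cycint_loc; rewrite rpredB ?rpred1 // rpredX ?cycint_gen.
have e0 : (0 < ramif_exp n p * p.-1)%N.
  by rewrite muln_gt0 expn_gt0 prime_gt0 //= -subn1 subn_gt0 prime_gt1.
set e := (_ * _)%N in e0 *; move=> Upe.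
have : unif p * unif p ^+ e.-1 \in units_in (Aloc q).
  rewrite -exprS prednK //; apply: (mem_eq (rpred_div Up Upe)).
  have p0 := units_in_neq0 Up.
  by rewrite invf_div mulrCA divff // mulr1.
by move/units_in_prodl; apply; rewrite ?rpredX.
Qed.

Section Sufficient.
Variables (l : nat) (b : K).
Hypotheses (l0 : (0 < l)%N) (sql : square_free l) (bl : b ^+ 2 = l%:R).
Hypothesis l_n : forall p, prime p -> (p %| l)%N -> (p %| n)%N.
Hypothesis n_l : forall p, prime p -> odd p -> (p %| n)%N -> (p %| l)%N /\ (p %% 4 = 3)%N.
Hypothesis n_2 : (2 %| n)%N -> (2 <= logn 2 n)%N.
Hypothesis l_2 : (2 %| l)%N -> (3 <= logn 2 n)%N.

Let bexp p := (if (p %| l)%N then (ramif_exp n p * p.-1)./2 else 0)%N.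
Let kexp p := ((dexp p - bexp p)./2)%N.

Lemma sqrt_bexp p : prime p -> (p %| n)%N ->
  iota b / unif p ^+ bexp p \in units_in (Aloc p) /\ dexp p = (bexp p + (kexp p).*2)%N.
Proof.
move=> pp pn; have upi := uniformizer_ram prim_z pp pn.
have [op|] := boolP (odd p).
  have [pl p4] := n_l pp op pn.
  have eh : (ramif_exp n p * p.-1 = (ramif_exp n p * p.-1./2).*2)%N.
    by rewrite {1}(odd_pred_half op) doubleMr.
  have [os hs osh] := dexp_sub_odd pp op pn.
  rewrite /kexp /bexp pl eh doubleK; split.
    exact: (sqrt_unif gen_z upi l0 sql (iota_sq bl) pl eh).
  rewrite -eh even_halfK ?subnKC // osh negbK; move: p4; lia.
move=> ep; have p2 : p = 2%N by case: (even_prime pp) ep => // ->.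
rewrite {}p2 {ep} in pp pn upi *.
have r2 := n_2 pn.
have Ee : (ramif_exp n 2 = (2 ^ (logn 2 n).-2).*2)%N.
  by rewrite /ramif_exp -mul2n -expnS; congr (2 ^ _)%N; lia.
rewrite /kexp /bexp; case: ifP => l2.
  split.
    by apply: (sqrt_unif gen_z upi l0 sql (iota_sq bl) l2); rewrite muln1 Ee doubleK.
  have r3 := l_2 l2.
  have E4 : (2 ^ (logn 2 n).-2 = (2 ^ (logn 2 n - 3)).*2)%N.
    by rewrite -mul2n -expnS; congr (2 ^ _)%N; lia.
  rewrite muln1 Ee doubleK E4; set x := (2 ^ _)%N.
  by have : (3 * x <= logn 2 n * x)%N; [rewrite leq_mul2r r3 orbT | lia].
split; first by rewrite expr0 divr1 (sqrt_unit gen_z upi l0 (iota_sq bl)) ?l2.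
rewrite muln1 Ee; set x := (2 ^ _)%N.
by have : (2 * x <= logn 2 n * x)%N; [rewrite leq_mul2r r2 orbT | lia].
Qed.

(** The conditions make the valuation of the different minus that of b an even
    number 2 k_p at each p dividing n, so g, the product of the pi_p^(k_p), has
    g^2 b associate to the different, locally at every prime. *)
Lemma level_sufficient : ModT K l.
Proof.
have b0 : b != 0.
  by rewrite -sqrf_eq0 bl natr_neq0.
have B0 : iota b != 0 by rewrite fmorph_eq0.
pose g := \prod_(p <- primes n) unif p ^+ kexp p.
have primesP p : p \in primes n -> prime p /\ (p %| n)%N by rewrite mem_primes => /and3P[].
have g0 : g != 0.
  rewrite prodf_seq_neq0; apply/allP => p /primesP[pp pn] /=.
  by rewrite expf_neq0 // (ramif_unif_neq0 prim_z).
(* away from q all the other uniformizers are units *)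
have rest q s : {subset s <= primes n} -> q \notin s -> prime q ->
    \prod_(p <- s) unif p ^+ kexp p \in units_in (Aloc q).
  move=> sn qs qq; rewrite big_seq rpred_prod // => p ps; rewrite rpredX //.
  have [pp pn] := primesP _ (sn _ ps); apply: ramif_unif_unit => //.
  by apply: contraNneq qs => <-.
have Uloc q : prime q -> diff / (g ^+ 2 * iota b) \in units_in (Aloc q).
  move=> qq; have [qn|qn] := boolP (q %| n)%N; last first.
    have Ugq : g \in units_in (Aloc q).
      by apply: rest => //; rewrite mem_primes (negPf qn) !andbF.
    have Ubq : iota b \in units_in (Aloc q).
      apply: (sqrt_unit gen_z (uniformizer_unram prim_z qq qn) l0 (iota_sq bl)).
      by apply: contraNN qn; apply: l_n.
    by rewrite rpred_div ?(deriv_Phi_unram prim_z) // rpredM ?rpredX.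
  have qin : q \in primes n by rewrite mem_primes qq n_gt0.
  have [Ub es] := sqrt_bexp qq qn.
  have Us := deriv_Phi_ram prim_z qq qn; rewrite es in Us.
  have Ur : \prod_(p <- rem q (primes n)) unif p ^+ kexp p \in units_in (Aloc q).
    apply: rest => //; first exact: mem_rem.
    by rewrite mem_rem_uniqF ?primes_uniq.
  have r0 := units_in_neq0 Ur.
  have gE : g = unif q ^+ kexp q * \prod_(p <- rem q (primes n)) unif p ^+ kexp p.
    by rewrite /g (big_rem q).
  apply: (mem_eq (rpred_div Us (rpredM Ub (rpredX 2 Ur)))).
  rewrite gE (exprD (unif q)) -muln2 (exprM (unif q)).
  have u0 := ramif_unif_neq0 prim_z qq qn.
  set R := \prod_(p <- _) _ in r0 *; clearbody R.
  set X := unif q ^+ kexp q; set Y := unif q ^+ bexp q.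
  have X0 : X != 0 by rewrite expf_neq0.
  have Y0 : Y != 0 by rewrite expf_neq0.
  by field; rewrite r0 X0 Y0 B0.
have Ug : diff / (g ^+ 2 * iota b) \in units_in A.
  apply/units_inP; split.
  - exact: units_in_neq0 (Uloc 2%N isT).
  - by apply: (cyc_locglob gen_z) => q /Uloc/units_in_sub.
  - by apply: (cyc_locglob gen_z) => q /Uloc/units_in_subV.
have Ag : g \in A.
  rewrite /g big_seq rpred_prod // => p /primesP[pp pn].
  by have [_ [Ap _] _ _ _] := uniformizer_ram prim_z pp pn; rewrite rpredX.
have Ucg : conj g / g \in units_in A.
  rewrite /g rmorph_prod -prodf_div big_seq rpred_prod // => p /primesP[pp pn].
  by rewrite rmorphXn -expr_div_n rpredX // (conj_ramif_unif prim_z conj_z).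
have [I [fracI modI]] := modular_exists prim_z gen_z conj_z fixK unit_z b0 g0 Ag Ucg Ug.
exact: (ModT_intro l0 sql b0 fracI modI bl).
Qed.

End Sufficient.
End Levels.

(** * Square roots in the real subfield *)

Lemma logn_prod_primes (s : seq nat) q : uniq s -> {in s, forall p, prime p} -> prime q ->
  logn q (\prod_(p <- s) p)%N = (q \in s).
Proof.
elim: s => [|p s IH] /=; first by rewrite big_nil logn1.
case/andP=> ps us sP qq; have pp := sP p (mem_head _ _).
have sP' : {in s, forall p, prime p} by move=> x xs; apply: sP; rewrite inE xs orbT.
rewrite big_cons lognM ?(prime_gt0 pp) //; last first.
  by rewrite big_seq prodn_cond_gt0 // => x /sP'/prime_gt0.
rewrite IH // logn_prime // inE.
by case: eqVneq => [->|] //; rewrite (negPf ps).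
Qed.

Lemma prod_primes_gt0 (s : seq nat) : {in s, forall p, prime p} -> (0 < \prod_(p <- s) p)%N.
Proof. by move=> sP; rewrite big_seq prodn_cond_gt0 // => x /sP/prime_gt0. Qed.

Lemma squarefree_prod_primes (s : seq nat) : uniq s -> {in s, forall p, prime p} ->
  square_free (\prod_(p <- s) p)%N.
Proof.
move=> us sP d d2; have m0 := prod_primes_gt0 sP.
have d0 : (0 < d)%N by rewrite lt0n; apply: contraTneq d2 => ->; rewrite exp0n // dvd0n -lt0n.
apply/eqP; rewrite eqn_leq d0 andbT leqNgt; apply/negP => d1.
have qq := pdiv_prime d1.
have : (pdiv d ^ 2 %| \prod_(p <- s) p)%N.
  by rewrite (dvdn_trans _ d2) // dvdn_exp2r // pdiv_dvd.
by rewrite pfactor_dvdn // logn_prod_primes //; case: (_ \in _).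
Qed.

Lemma squarefree_eq_prod l (s : seq nat) : (0 < l)%N -> square_free l ->
  uniq s -> {in s, forall p, prime p} ->
  (forall p, prime p -> (p %| l)%N = (p \in s)) -> l = (\prod_(p <- s) p)%N.
Proof.
move=> l0 sql us sP ls; apply: eqn_from_log => //; first exact: prod_primes_gt0.
move=> q; have [qq|nq] := boolP (prime q); last by rewrite [LHS]lognE [RHS]lognE (negPf nq).
rewrite logn_prod_primes // -ls //; case: (boolP (q %| l)%N) => ql.
  by rewrite squarefree_logn.
by rewrite [LHS]lognE qq l0 (negPf ql).
Qed.

Lemma prime_dvd_prod_primes (s : seq nat) q : uniq s -> {in s, forall p, prime p} -> prime q ->
  (q %| \prod_(p <- s) p)%N = (q \in s).
Proof.
move=> us sP qq; rewrite -[q in LHS]expn1 pfactor_dvdn ?prod_primes_gt0 //.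
by rewrite logn_prod_primes //; case: (_ \in _).
Qed.

Section RealSquareRoots.
Variables (F : fieldExtType rat) (n : nat) (z : F).
Hypothesis prim_z : n.-primitive_root z.
Variables (conj : {rmorphism F -> F}).
Hypothesis conj_z : conj z = z^-1.

Lemma conj_expr k : conj (z ^+ k) = (z ^+ k)^-1.
Proof. by rewrite rmorphXn conj_z exprVn. Qed.

(** With h of order p = 2 t + 1, take the product of the h^j - h^(-j) for
    1 <= j <= t. Its square is (-1)^t times the product of the
    (1 - h^(2j)) (1 - h^(-2j)), which is p; conjugation changes each of its t
    factors by a sign, and t is odd. *)
Lemma sqrt_opp_prime p : prime p -> (p %| n)%N -> (p %% 4 = 3)%N ->
  exists2 g, g ^+ 2 = - p%:R & conj g = - g.
Proof.
move=> pp pn p4; pose h := z ^+ (n %/ p); pose t := p./2.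
have ph : p.-primitive_root h := dvdn_prim_root prim_z pn.
have pt : p = (t + t).+1 by rewrite /t; lia.
have ot : odd t by rewrite /t; lia.
have h0 : h != 0 by rewrite expf_neq0 // (prim_root_neq0 prim_z).
have pw : p.-primitive_root (h ^+ 2).
  by rewrite prim_root_exp_coprime // coprime2n pt /= addnn odd_double.
have ch k : conj (h ^+ k) = (h ^+ k)^-1 by rewrite -exprM conj_expr.
exists (\prod_(i < t) (h ^+ i.+1 - (h ^+ i.+1)^-1)).
  rewrite -(prod_one_sub_prim pw) pt /= big_split_ord /=.
  rewrite [X in - (_ * X)](reindex_inj rev_ord_inj) /= -big_split /=.
  rewrite -prodrXl.
  transitivity (\prod_(i < t)
    (-1 * ((1 - h ^+ 2 ^+ i.+1) * (1 - h ^+ 2 ^+ (t + (t - i.+1)).+1)))).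
    apply: eq_bigr => i _.
    have -> : h ^+ 2 ^+ (t + (t - i.+1)).+1 = (h ^+ i.+1)^-1 ^+ 2.
      have hi0 : h ^+ 2 ^+ i.+1 != 0 by rewrite expf_neq0 // expf_neq0.
      apply: (mulIf hi0); rewrite -exprD.
      have -> : ((t + (t - i.+1)).+1 + i.+1 = p)%N by have := ltn_ord i; rewrite pt; lia.
      rewrite (prim_expr_order pw) (exprAC h) -exprMn mulVf ?expr1n //.
      by rewrite expf_neq0.
    rewrite (exprAC h); set x := h ^+ _.
    have x0 : x != 0 by rewrite expf_neq0.
    by field.
  by rewrite big_split /= prodr_const card_ord -signr_odd ot expr1 mulN1r.
rewrite rmorph_prod; transitivity (\prod_(i < t) (-1 * (h ^+ i.+1 - (h ^+ i.+1)^-1))).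
  by apply: eq_bigr => i _; rewrite rmorphB fmorphV ch invrK; ring.
by rewrite big_split /= prodr_const card_ord -signr_odd ot expr1 mulN1r.
Qed.

Lemma sqrt_signed_prod (s : seq nat) :
    (forall p, p \in s -> [/\ prime p, (p %| n)%N & (p %% 4 = 3)%N]) ->
  exists2 g, g ^+ 2 = (-1) ^+ size s * (\prod_(p <- s) p)%N%:R
    & conj g = (-1) ^+ size s * g.
Proof.
elim: s => [|p s IH] sP.
  by exists 1; rewrite ?big_nil ?expr0 ?expr1n ?mulr1 ?rmorph1.
have [|g g2 cg] := IH; first by move=> q qs; apply: sP; rewrite inE qs orbT.
have [pp pn p4] := sP p (mem_head _ _).
have [h h2 ch] := sqrt_opp_prime pp pn p4.
exists (h * g).
  by rewrite exprMn h2 g2 /= big_cons natrM exprS; ring.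
by rewrite rmorphM ch cg /= exprS; ring.
Qed.

Lemma sqrt_prod_mod4 (s : seq nat) : (4 %| n)%N ->
    (forall p, p \in s -> [/\ prime p, (p %| n)%N & (p %% 4 = 3)%N]) ->
  exists2 g, g ^+ 2 = (\prod_(p <- s) p)%N%:R & conj g = g.
Proof.
move=> n4 sP; have [g g2 cg] := sqrt_signed_prod sP.
(* multiplying a square root of -p by i makes it real *)
pose i := z ^+ (n %/ 4).
have pi : 4.-primitive_root i := dvdn_prim_root prim_z n4.
have i2 : i ^+ 2 = -1.
  have : (i ^+ 2 - 1) * (i ^+ 2 + 1) = 0.
    by rewrite -subr_sqr -exprM (prim_expr_order pi) expr1n subrr.
  move/eqP; rewrite mulf_eq0 subr_eq0 -(prim_order_dvd pi) /=.
  by rewrite addr_eq0 => /eqP.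
have ci : conj i = - i.
  have i0 : i != 0 by rewrite expf_neq0 // (prim_root_neq0 prim_z).
  rewrite conj_expr -/i; apply: (mulIf i0).
  by rewrite mulVf // mulNr -expr2 i2 opprK.
exists (i ^+ size s * g).
  rewrite exprMn g2 mulrA -exprM mulnC exprM i2 -exprMn.
  by rewrite mulrNN mulr1 expr1n mul1r.
rewrite rmorphM cg rmorphXn ci mulrA -exprMn; congr (_ ^+ _ * _); ring.
Qed.

Lemma sqrt_two : (8 %| n)%N -> exists2 g, g ^+ 2 = 2%:R & conj g = g.
Proof.
move=> n8; pose w := z ^+ (n %/ 8).
have pw : 8.-primitive_root w := dvdn_prim_root prim_z n8.
have w0 : w != 0 by rewrite expf_neq0 // (prim_root_neq0 prim_z).
have w4 : w ^+ 4 = -1.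
  have : (w ^+ 4 - 1) * (w ^+ 4 + 1) = 0.
    by rewrite -subr_sqr -exprM (prim_expr_order pw) expr1n subrr.
  move/eqP; rewrite mulf_eq0 subr_eq0 -(prim_order_dvd pw) /=.
  by rewrite addr_eq0 => /eqP.
exists (w + w^-1); last by rewrite rmorphD fmorphV conj_expr -/w invrK addrC.
have -> : (w + w^-1) ^+ 2 = 2%:R + (w ^+ 4 + 1) / w ^+ 2 by field.
by rewrite w4 addNr mul0r addr0.
Qed.

End RealSquareRoots.

(** * The set of levels *)

Section Classification.
Variables (F K : fieldExtType rat) (n : nat) (z : F).
Hypothesis prim_z : n.-primitive_root z.
Hypothesis gen_z : rat_generated z.
Variables (iota : {rmorphism K -> F}) (conj : {rmorphism F -> F}).
Hypothesis conj_z : conj z = z^-1.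
Hypothesis fixK : forall x, conj x = x <-> exists y, x = iota y.

Local Notation A := (cycint z).
Let odd_primes := [seq p <- primes n | odd p].
Let N := (\prod_(p <- odd_primes) p)%N.
Let n_gt0 : (0 < n)%N := prim_order_gt0 prim_z.

Let odd_primes_uniq : uniq odd_primes.
Proof. by rewrite filter_uniq // primes_uniq. Qed.

Let mem_odd_primes p : (p \in odd_primes) = [&& odd p, prime p & (p %| n)%N].
Proof. by rewrite mem_filter mem_primes n_gt0. Qed.

Let odd_primes_prime : {in odd_primes, forall p, prime p}.
Proof. by move=> p; rewrite mem_odd_primes => /and3P[]. Qed.

Let two_odd_primes_prime : {in 2%N :: odd_primes, forall p, prime p}.
Proof. by move=> p; rewrite inE => /orP[/eqP->|/odd_primes_prime]. Qed.

Let two_odd_primes_uniq : uniq (2%N :: odd_primes).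
Proof. by rewrite /= odd_primes_uniq mem_odd_primes. Qed.

(** K = Q: the only level is that of the unimodular lattice Z. *)
Lemma ModT_trivial : n = 1%N -> ModT K = [set 1%N].
Proof.
move=> n1; apply/seteqP; split=> l /=.
  move=> Ml; have [l0 sql _] := ModT_sqrt Ml.
  rewrite (_ : 1%N = \prod_(p <- [::]) p)%N; last by rewrite big_nil.
  apply: squarefree_eq_prod => //.
  move=> p pp; rewrite in_nil; apply/negP => /(level_dvd prim_z gen_z iota Ml pp).
  by rewrite n1 dvdn1 => /eqP p1; rewrite p1 in pp.
move=> ->.
have d0 : (totient n).-1 = 0%N by rewrite n1.
have ec : euler_coef n z 0 = 1 by rewrite -d0 (euler_coef_top prim_z).
have tr x : field_trace x = top_coord n z (iota x).
  rewrite (@field_trace_dyad K 1 x (fun _ y => top_coord n z (iota (x * y))) (fun _ => 1)).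
  - by rewrite big_ord1 mulr1.
  - move=> _ a y y'; rewrite mulrDr rmorphD -scalerAr.
    by rewrite (rat_linear (rmorphB iota)) linearP.
  - move=> y; rewrite big_ord1; apply: (fmorph_inj iota).
    rewrite (rat_linear (rmorphB iota)) rmorph1.
    have := dual_frame prim_z gen_z (iota (x * y)).
    by rewrite d0 big_ord1 expr0 mulr1 ec.
have memA x : iota x \in A <-> top_coord n z (iota x) \is a Num.int.
  split=> [|/intrP[c cE]]; first exact: top_coord_int.
  have := dual_frame prim_z gen_z (iota x).
  rewrite d0 big_ord1 expr0 mulr1 cE => ->.
  by rewrite scaler_int rpredMz // euler_coef_int.
have modA : [set x : K | iota x \in A] =
    [set 1 * x | x in dual_lattice [set x : K | iota x \in A] 1].
  apply/modularP; rewrite ?oner_neq0 // => x /=; rewrite invr1.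
  split=> [Ax y Ay | /(_ 1)]; rewrite ?mulr1 mul1r tr.
    by apply/memA; rewrite rmorphM rpredM.
  by rewrite rmorph1 rpred1 => /(_ isT)/memA.
apply: (ModT_intro _ _ _ _ modA); rewrite ?oner_neq0 ?expr1n //.
- by move=> d; rewrite dvdn1 -(exp1n 2) eqn_exp2r // => /eqP.
- split; last first.
  + exists 1; first by split; [exact: integral1 | rewrite oner_neq0].
    by move=> x /= Ax; rewrite mul1r; apply/(ring_of_integersE prim_z gen_z iota).
  + by exists 1; rewrite ?oner_neq0 //= rmorph1 rpred1.
  split=> [|x y|c x] /=; first by rewrite rmorph0 rpred0.
    by move=> Ax Ay; rewrite rmorphD rpredD.
  by move=> /(ring_of_integersE prim_z gen_z iota) Ac Ax; rewrite rmorphM rpredM.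
Qed.

Lemma odd_ramified_prodE : (n = 1%N \/ z - z^-1 \in units_in A) ->
  odd_ramified_prod K = N.
Proof.
move=> unit_z.
suff E : [set p : nat | odd p /\ ramified K p] = [set` odd_primes].
  rewrite /odd_ramified_prod E /N [RHS]fsbig_seq //.
apply/seteqP; split=> p /=; rewrite mem_odd_primes.
  move=> [op rp]; have pp : prime p by case: rp.
  rewrite op pp /=; apply: contraPT rp => pn.
  exact: (unramified prim_z gen_z iota pp pn).
case/and3P=> op pp pn; split=> //.
case: unit_z => [n1|unit_z].
  by move: pn; rewrite n1 dvdn1 => /eqP p1; rewrite p1 in pp.
exact: (ramified_dvd prim_z gen_z conj_z fixK unit_z pp op pn).
Qed.

Hypothesis unit_z : z - z^-1 \in units_in A.

Lemma ModT_mod4 l p : ModT K l -> prime p -> (p %| n)%N -> (p %% 4 <> 1)%N.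
Proof.
move=> Ml pp pn p1; have op : odd p by move: p1; lia.
by have [_] := level_odd prim_z gen_z conj_z fixK unit_z Ml pp op pn; rewrite p1.
Qed.

Lemma level_odd_primes l p : ModT K l -> prime p -> odd p ->
  (p %| l)%N = (p \in odd_primes).
Proof.
move=> Ml pp op; rewrite mem_odd_primes op pp /=.
apply/idP/idP => [|pn]; first exact: (level_dvd prim_z gen_z iota Ml).
by have [] := level_odd prim_z gen_z conj_z fixK unit_z Ml pp op pn.
Qed.

Lemma level_odd_eq l : ModT K l -> ~~ (2 %| l)%N -> l = N.
Proof.
move=> Ml l2; have [l0 sql _] := ModT_sqrt Ml.
apply: squarefree_eq_prod => // p pp; have [op|] := boolP (odd p).
  exact: level_odd_primes.
move=> ep; have -> : p = 2%N by case: (even_prime pp) ep => // ->.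
by rewrite (negPf l2) mem_odd_primes.
Qed.

Lemma level_even_eq l : ModT K l -> (2 %| l)%N -> l = (2 * N)%N.
Proof.
move=> Ml l2; have [l0 sql _] := ModT_sqrt Ml.
have -> : (2 * N)%N = (\prod_(p <- 2%N :: odd_primes) p)%N by rewrite big_cons.
apply: squarefree_eq_prod => // p pp; rewrite inE; have [op|] := boolP (odd p).
  by rewrite (level_odd_primes Ml) //; case: eqVneq => // p2; rewrite p2 in op.
move=> ep; have -> : p = 2%N by case: (even_prime pp) ep => // ->.
by rewrite l2.
Qed.

Hypothesis mod4 : forall p, prime p -> (p %| n)%N -> (p %% 4 <> 1)%N.
Hypothesis n_mod4 : (n %% 4 <> 2)%N.

Let odd_primes_mod4 p : p \in odd_primes -> [/\ prime p, (p %| n)%N & (p %% 4 = 3)%N].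
Proof.
rewrite mem_odd_primes => /and3P[op pp pn]; split=> //.
by have := mod4 pp pn; move: op; lia.
Qed.

Lemma level_N : (exists2 g : F, g ^+ 2 = N%:R & conj g = g) -> ModT K N.
Proof.
case=> g g2 /fixK[b gb]; subst g.
have N_dvd p : prime p -> (p %| N)%N = (p \in odd_primes).
  by move=> pp; rewrite prime_dvd_prod_primes.
apply: (level_sufficient prim_z gen_z conj_z fixK unit_z (b := b)).
- exact: prod_primes_gt0.
- exact: squarefree_prod_primes.
- by apply: (fmorph_inj iota); rewrite rmorphXn g2 rmorph_nat.
- by move=> p pp; rewrite N_dvd // => /odd_primes_mod4[].
- move=> p pp op pn; rewrite N_dvd // mem_odd_primes op pp pn; split=> //.
  by have [] := @odd_primes_mod4 p; rewrite ?mem_odd_primes ?op ?pp.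
- move=> n2; rewrite -pfactor_dvdn //.
  by move: n2 n_mod4; lia.
- by rewrite N_dvd // mem_odd_primes.
Qed.

Lemma level_2N : (8 %| n)%N -> ModT K (2 * N)%N.
Proof.
move=> n8; have n4 : (4 %| n)%N by apply: dvdn_trans n8.
have [g g2 cg] := sqrt_prod_mod4 prim_z conj_z n4 odd_primes_mod4.
have [h h2 ch] := sqrt_two prim_z conj_z n8.
have /fixK[b gb] : conj (h * g) = h * g by rewrite rmorphM ch cg.
have -> : (2 * N)%N = (\prod_(p <- 2%N :: odd_primes) p)%N by rewrite big_cons.
set M := (\prod_(p <- _) _)%N.
have M_dvd p : prime p -> (p %| M)%N = (p == 2%N) || (p \in odd_primes).
  by move=> pp; rewrite prime_dvd_prod_primes.
apply: (level_sufficient prim_z gen_z conj_z fixK unit_z (b := b)).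
- exact: prod_primes_gt0.
- exact: squarefree_prod_primes.
- apply: (fmorph_inj iota); rewrite rmorphXn /= -gb exprMn h2 g2 rmorph_nat /M.
  by rewrite big_cons natrM.
- move=> p pp; rewrite M_dvd // => /orP[/eqP->|/odd_primes_mod4[] //].
  by apply: dvdn_trans n8.
- move=> p pp op pn; rewrite M_dvd // mem_odd_primes op pp pn orbT; split=> //.
  by have [] := @odd_primes_mod4 p; rewrite ?mem_odd_primes ?op ?pp.
- by move=> _; rewrite -pfactor_dvdn.
- by move=> _; rewrite -pfactor_dvdn.
Qed.

Lemma ModT_no_sqrt2 : ~~ (8 %| n)%N -> (exists2 g : F, g ^+ 2 = N%:R & conj g = g) ->
  ModT K = [set N].
Proof.
move=> n8 sqN; apply/seteqP; split=> l /=; last by move=> ->; apply: level_N.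
move=> Ml; apply: level_odd_eq => //; have [n2|n2] := boolP (2 %| n)%N.
  apply: (level_two prim_z gen_z conj_z fixK unit_z Ml).
  apply/eqP; rewrite eqn_leq leqNgt -!pfactor_dvdn //.
  by move: n2 n_mod4 n8; lia.
by apply: contraNN n2; apply: (level_dvd prim_z gen_z iota Ml).
Qed.

Lemma ModT_odd_even : odd n -> ~~ odd (size (primes n)) -> ModT K = [set N].
Proof.
move=> on es; apply: ModT_no_sqrt2; first by move: on; lia.
have sE : odd_primes = primes n.
  apply/all_filterP/allP => p; rewrite mem_primes => /and3P[_ _ pn].
  exact: dvdn_odd on.
have [g g2 cg] := sqrt_signed_prod prim_z conj_z odd_primes_mod4.
exists g; last by rewrite cg -signr_odd sE (negPf es) expr0 mul1r.
by rewrite g2 -signr_odd sE (negPf es) expr0 mul1r -sE.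
Qed.

Lemma ModT_odd_odd : odd n -> odd (size (primes n)) -> ModT K = set0.
Proof.
move=> on os; apply/seteqP; split=> // l Ml.
have l2 : ~~ (2 %| l)%N.
  apply/negP => /(level_dvd prim_z gen_z iota Ml (isT : prime 2)) n2; move: on n2; lia.
have lN := level_odd_eq Ml l2.
have [_ _ [b [_ [b0 _ _ bl]]]] := ModT_sqrt Ml.
have sE : odd_primes = primes n.
  apply/all_filterP/allP => p; rewrite mem_primes => /and3P[_ _ pn].
  exact: dvdn_odd on.
have [g g2 _] := sqrt_signed_prod prim_z conj_z odd_primes_mod4.
have N0 : N%:R != 0 :> F by rewrite natr_neq0 // prod_primes_gt0.
have /eqP[] := @no_sqrt_m1 _ _ _ prim_z gen_z (g / iota b) on.
rewrite expr_div_n -rmorphXn bl lN rmorph_nat g2 -signr_odd {1}sE os expr1.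
by rewrite -mulrA divff // mulr1.
Qed.

Lemma ModT_4 m : odd m -> n = (4 * m)%N -> ModT K = [set N].
Proof.
move=> om nE; apply: ModT_no_sqrt2; first by rewrite nE; move: om; lia.
have n4 : (4 %| n)%N by rewrite nE dvdn_mulr.
exact: (sqrt_prod_mod4 prim_z conj_z n4 odd_primes_mod4).
Qed.

Lemma ModT_8 : (8 %| n)%N -> ModT K = [set N; (2 * N)%N].
Proof.
move=> n8; apply/seteqP; split=> l /=.
  move=> Ml; have [l2|l2] := boolP (2 %| l)%N.
    by right; apply: level_even_eq.
  by left; apply: level_odd_eq.
case=> ->; last exact: level_2N.
apply/level_N/(sqrt_prod_mod4 prim_z conj_z) => //.
by apply: dvdn_trans n8.
Qed.

End Classification.

(** * Complex conjugation on a cyclotomic field *)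

Section ComplexConjugation.
Variables (F : fieldExtType rat) (n : nat) (z : F).
Hypothesis prim_z : n.-primitive_root z.
Hypothesis gen_z : rat_generated z.

(** 1/z is a root of the minimal polynomial of z. *)
Lemma conj_exists : exists conj : {rmorphism F -> F}, conj z = z^-1.
Proof.
have full : <<1%AS; z>>%VS = fullv.
  apply/eqP; rewrite eqEsubv subvf; apply/subvP => x _; have [P ->] := gen_z x.
  by apply/Fadjoin_polyP; exists (map_poly (in_alg F) P) => //; apply/polyOver1P; exists P.
have rz : root (map_poly (\1%VF : 'End(F)) (minPoly 1%AS z)) z^-1.
  rewrite lfun1_poly; have /polyOver1P[q qE] := minPolyOver 1%AS z.
  have : root (map_poly (in_alg F) q) z by rewrite -qE root_minPoly.
  move/(Cyclotomic_min prim_z)/dvdpP => [s sE].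
  rewrite qE sE rmorphM /= rootM map_poly_intr_in_alg.
  by rewrite (Cyclotomic_root (prim_root_inv prim_z)) orbT.
have /kHom_monoid_morphism hM : kHom 1 {:F} (kHomExtend 1%AS \1%VF z z^-1).
  by have := kHomExtendP (sub1v 1%AS) (kHom1 1%AS 1%AS) rz; rewrite full.
pose conj : {rmorphism F -> F} := HB.pack (kHomExtend 1%AS \1%VF z z^-1 : F -> F)
  (GRing.isZmodMorphism.Build F F _ (raddfB _)) (GRing.isMonoidMorphism.Build F F _ hM).
by exists conj; apply: kHomExtend_val (kHom1 1%AS 1%AS) rz.
Qed.

Variables (K : fieldExtType rat) (iota : {rmorphism K -> F}) (conj : {rmorphism F -> F}).
Hypothesis conj_z : conj z = z^-1.
Variable t : K.
Hypothesis iota_t : iota t = z + z^-1.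
Hypothesis gen_t : rat_generated t.

(** F = K + K z, because z^2 = (z + z^-1) z - 1. *)
Lemma conj_fixed : (z = 1 \/ z != z^-1) ->
  forall x, conj x = x <-> exists y, x = iota y.
Proof.
move=> z1 x.
have conj_iota y : conj (iota y) = iota y.
  have [P ->] := gen_t y; rewrite -horner_map -map_poly_comp iota_t.
  have -> : map_poly (iota \o in_alg K) P = map_poly (in_alg F) P.
    apply: eq_map_poly => c.
    by rewrite (fmorph_eq_rat (iota \o in_alg K)) (fmorph_eq_rat (in_alg F)).
  by rewrite conj_horner_rat rmorphD fmorphV conj_z invrK addrC.
split=> [cx|[y ->]]; last exact: conj_iota.
have z0 := prim_root_neq0 prim_z.
have [a [b xE]] : exists a b, x = iota a + iota b * z.
  have [P ->] := gen_z x; elim/poly_ind: P => [|P c [a [b IH]]].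
    by exists 0, 0; rewrite map_poly0 horner0 !rmorph0 mul0r addr0.
  rewrite rmorphD rmorphM /= map_polyX map_polyC /= hornerMXaddC IH.
  exists (in_alg K c - b), (a + b * t).
  rewrite rmorphB rmorphD rmorphM iota_t.
  have -> : iota c%:A = c%:A.
    exact: etrans (fmorph_eq_rat (iota \o in_alg K) c) (esym (fmorph_eq_rat (in_alg F) c)).
  by field.
case: z1 => [z1|zz]; first by exists (a + b); rewrite xE z1 mulr1 rmorphD.
exists a; move: cx; rewrite xE rmorphD rmorphM !conj_iota conj_z => /addrI/eqP.
rewrite -subr_eq0 -mulrBr mulf_eq0 subr_eq0 eq_sym [z^-1 == z]eq_sym (negPf zz) orbF.
by rewrite eq_sym => /eqP ->; rewrite mul0r addr0.
Qed.

End ComplexConjugation.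

Lemma subvs_generated (L : fieldExtType rat) (x : L) (v : subvs_of <<1; x>>) :
  exists P : {poly rat},
    v = (map_poly (in_alg (subvs_of <<1; x>>)) P).[Subvs (memv_adjoin 1%AS x)].
Proof.
have /Fadjoin_polyP[q /polyOver1P[P ->] vE] := subvsP v.
exists P; apply: val_inj; rewrite /= vE -[RHS]/(vsval _) -horner_map -map_poly_comp.
congr (_.[_]); apply: eq_map_poly => c.
by rewrite /= algid1.
Qed.

Unset Implicit Arguments.

Theorem proposition4p12 (n : nat) (hn0 : (0 < n)%N) (hn4 : (n %% 4 <> 2)%N)
    (hnpp : ~ prime_power n)
    (L : fieldExtType rat) (zeta : L) (hzeta : n.-primitive_root zeta) :
  let K : fieldExtType rat := subvs_of <<1%VS; zeta + zeta^-1>> in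
  let ntilde := odd_ramified_prod K in
  ((exists p : nat, [/\ prime p, (p %| n)%N & (p %% 4 = 1)%N]) ->
     ModT K = set0) /\
  (~ (exists p : nat, [/\ prime p, (p %| n)%N & (p %% 4 = 1)%N]) ->
     [/\ odd n -> ~~ odd (size (primes n)) -> ModT K = [set ntilde],
         odd n -> odd (size (primes n)) -> ModT K = set0,
         forall m : nat, odd m -> n = (4 * m)%N -> ModT K = [set ntilde]
       & forall r m : nat, (3 <= r)%N -> odd m -> n = (2 ^ r * m)%N ->
           ModT K = [set ntilde; (2 * ntilde)%N]]).
Proof.
move=> K ntilde.
pose F : fieldExtType rat := subvs_of <<1%VS; zeta>>.
pose z : F := Subvs (memv_adjoin 1%AS zeta).
have prim_z : n.-primitive_root z.
  by rewrite -(fmorph_primitive_root (vsval : {rmorphism F -> L})).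
have gen_z : rat_generated z.
  exact: subvs_generated.
pose t : K := Subvs (memv_adjoin 1%AS (zeta + zeta^-1)).
have gen_t : rat_generated t.
  exact: subvs_generated.
have KF (y : K) : vsval y \in <<1; zeta>>%VS.
  have /Fadjoin_polyP[q q1 ->] := subvsP y.
  apply: rpred_horner; first by apply: polyOverSv q1; exact: subv_adjoin.
  by rewrite rpredD ?rpredV ?memv_adjoin.
pose f (y : K) : F := Subvs (KF y).
have fB : zmod_morphism f by move=> x y; apply: val_inj.
have fM : monoid_morphism f.
  by split=> [|x y]; apply: val_inj => //=; rewrite !algid1.
pose iota : {rmorphism K -> F} := HB.pack f
  (GRing.isZmodMorphism.Build K F f fB) (GRing.isMonoidMorphism.Build K F f fM).
have iota_t : iota t = z + z^-1.
  by apply: val_inj; rewrite /= vsval_invf.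
have [conj conj_z] := conj_exists prim_z gen_z.
have [n1|n1] := eqVneq n 1%N.
  have z1 : z = 1 by move: (prim_expr_order prim_z); rewrite n1 expr1.
  have fixK := conj_fixed prim_z gen_z conj_z iota_t gen_t (or_introl z1).
  have NE := odd_ramified_prodE prim_z gen_z conj_z fixK (or_introl n1).
  have Mod1 := ModT_trivial prim_z gen_z iota n1.
  have nt1 : ntilde = 1%N by rewrite /ntilde NE n1 big_nil.
  split=> [[p [pp]]|_]; first by rewrite n1 dvdn1 => /eqP p1; rewrite p1 in pp.
  split.
  - by move=> _ _; rewrite nt1.
  - by rewrite n1.
  - by move=> m _; rewrite n1 => /eqP; rewrite eq_sym muln_eq1.
  - move=> r m r3 _; rewrite n1 => e1.
    by have : (2 ^ 3 %| 1)%N by rewrite [X in (_ %| X)%N]e1 dvdn_mulr // dvdn_exp2l.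
have n_gt1 : (1 < n)%N by rewrite ltn_neqAle eq_sym n1.
have unit_z := unit_sub_inv prim_z n_gt1 hnpp hn4.
have zz : z != z^-1 by rewrite -subr_eq0 (units_in_neq0 unit_z).
have fixK := conj_fixed prim_z gen_z conj_z iota_t gen_t (or_intror zz).
have NE : ntilde = _ := odd_ramified_prodE prim_z gen_z conj_z fixK (or_intror unit_z).
split=> [[p [pp pn p4]]|no1].
  apply/seteqP; split=> // l Ml.
  by case: (ModT_mod4 prim_z gen_z conj_z fixK unit_z Ml pp pn).
have mod4 p : prime p -> (p %| n)%N -> (p %% 4 <> 1)%N.
  by move=> pp pn p4; apply: no1; exists p.
rewrite NE; split.
- exact: (ModT_odd_even prim_z gen_z conj_z fixK unit_z mod4 hn4).
- exact: (ModT_odd_odd prim_z gen_z conj_z fixK unit_z mod4).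
- exact: (ModT_4 prim_z gen_z conj_z fixK unit_z mod4 hn4).
- move=> r m r3 _ nE; apply: (ModT_8 prim_z gen_z conj_z fixK unit_z mod4 hn4).
  by rewrite nE dvdn_mulr // (@dvdn_exp2l 2 3).
Qed.
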